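(* For every $n\ge 1$, the poset $\Pi^{B'}_n$ is CL-shellable and Cohen-Macaulay.
   Context: Write $[n]=\{1,\dots,n\}$ and $[-n]=\{-1,\dots,-n\}$. A partition of type $B_n$ is a partition of $[n]\sqcup[-n]$ such that at most one block (the zero block, if it exists) contains some pair of opposite elements $j,-j$, the zero block is stable under negation, and all other blocks come in pairs of opposite blocks $\{S,-S\}$. A pointed partition of type $B_n$ is a partition of type $B_n$ together with the choice of one element of the zero block (if there is a zero block) and, for each pair of opposite blocks $\{S,-S\}$, the choice of a pair of opposite elements $s\in S$, $-s\in -S$. The chosen elements are called pointed. The poset $\Pi^B_n$ is the set of all pointed partitions of type $B_n$, with $\pi\le\nu$ if and only if the underlying partition of $\pi$ refines that of $\nu$ and the set of pointed elements of $\pi$ contains the set of pointed elements of $\nu$. Its minimal element $\hat 0$ is the partition into singletons and it has $2n$ maximal elements (a single zero block with one pointed element). All intervals $[\hat 0,\alpha]$ with $\alpha$ maximal are isomorphic, and $\Pi^{B'}_n$ denotes any such interval. CL-shellable (Björner–Wachs): a finite bounded poset $P$ in which all maximal chains have the same length is CL-shellable if it admits a CL-labelling, i.e. a labelling which assigns to every pair (maximal chain $m$ of $P$, edge of $m$) an element of some totally (or partially) ordered set, such that (1) if two maximal chains coincide along their first $d$ edges, then their labels coincide along these edges; (2) for every interval $[x,y]$ and every unrefinable chain $r$ from $\hat 0$ to $x$, there is a unique maximal chain of $[x,y]$ whose label sequence (computed with root $r$) is increasing, and this label sequence lexicographically precedes those of all other maximal chains of $[x,y]$. Cohen-Macaulay: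 for $\mathbb{K}$ the ring $\mathbb{Z}$ or any field, for every $x<y$ in the poset the reduced homology with coefficients in $\mathbb{K}$ of the order complex of the open interval $(x,y)$ vanishes except possibly in top degree $\ell-2$, where $\ell$ is the length of $[x,y]$. *)

(* Defs.v *)
From HB Require Import structures.
From mathcomp Require Import all_boot all_order all_algebra.

Set Implicit Arguments.
Unset Strict Implicit.
Unset Printing Implicit Defensive.

Import Order.TTheory GRing.Theory.
Local Open Scope order_scope.

(** * Finite posets *)

Section Posets.
Context {d : Order.disp_t} {P : finPOrderType d}.
Implicit Types (x y z : P) (c : seq P) (C : {set P}).

Definition maximal x := forall y, x <= y -> y = x.

Definition covers : rel P :=
  [rel x y | (x < y) && [forall z, ~~ (x < z < y)]].

(** [x :: c] is an unrefinable chain from [x] to [y], i.e. a maximal chain of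
    [[x, y]]; it has [size c] edges. The least element [x] is not in [c]. *)
Definition saturated x y c := path covers x c && (last x c == y).

Definition is_chain C := [forall x in C, forall y in C, x >=< y].

Definition interval_length x y : nat :=
  (\max_(C : {set P} | is_chain C && (C \subset [set z | x <= z <= y]%O))
     #|C|.-1)%N.

Definition open_interval x y : {set P} := [set z | x < z < y].

End Posets.

Section ClosedInterval.
Context {d : Order.disp_t} {P : finPOrderType d} {x y : P}.

Record closed_interval (le_xy : x <= y) := ClosedInterval {
  itv_val : P;
  _ : x <= itv_val <= y
}.
Variable le_xy : x <= y.
Local Notation itv := (closed_interval le_xy).

HB.instance Definition _ := [isSub for @itv_val le_xy].
HB.instance Definition _ := [Finite of itv by <:].
HB.instance Definition _ := [SubChoice_isSubPOrder of itv by <: with d].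

Fact itv_bottom_subproof : x <= x <= y. Proof. by rewrite lexx. Qed.
Fact itv_top_subproof : x <= y <= y. Proof. by rewrite lexx andbT. Qed.

Fact itv_le0x (z : itv) : (ClosedInterval le_xy itv_bottom_subproof) <= z.
Proof. by case: z => z z_xy; rewrite -Order.le_val /=; case/andP: z_xy. Qed.

Fact itv_lex1 (z : itv) : z <= (ClosedInterval le_xy itv_top_subproof).
Proof. by case: z => z z_xy; rewrite -Order.le_val /=; case/andP: z_xy. Qed.

HB.instance Definition _ := Order.hasBottom.Build d itv itv_le0x.
HB.instance Definition _ := Order.hasTop.Build d itv itv_lex1.

End ClosedInterval.

(** * CL-shellability *)

Section CLShellable.
Context {d : Order.disp_t} {P : finTBPOrderType d}.
Implicit Types (x y : P) (m c r t : seq P).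

(** A maximal chain of [P] is [\bot :: m]; its edges are numbered from 0, edge
    [i] ending at the [i]-th element of [m]. *)
Definition maximal_chain m := saturated (\bot : P) \top m.

Section Labelling.
Context {d' : Order.disp_t} {L : porderType d'}.

(** [lam m i] is the label of edge [i] of the maximal chain [\bot :: m]; its
    values for other [m] or for [i >= size m] are irrelevant. *)
Variable lam : seq P -> nat -> L.

(** The labels, in the maximal chain [\bot :: r ++ c ++ t], of the edges of the
    middle part [c]. *)
Definition label_seq r c t : seq L :=
  [seq lam (r ++ c ++ t) i | i <- iota (size r) (size c)].

Definition prefix_compatible :=
  forall m m' k, maximal_chain m -> maximal_chain m' ->
    take k m = take k m' -> forall i, (i < k)%N -> lam m i = lam m' i.

(** A chain of [[x, y]] only gets labels inside a maximal chain of [P], so it is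
    completed by the root [r] below [x] and by some [t] above [y]. Under
    [prefix_compatible] the labels do not depend on [t]. *)
Definition rooted_interval_condition :=
  forall x y r t, x <= y -> saturated \bot x r -> saturated y \top t ->
  exists c,
    [/\ saturated x y c,
        sorted <%O (label_seq r c t),
        forall c', saturated x y c' -> sorted <%O (label_seq r c' t) -> c' = c
      & forall c', saturated x y c' -> c' <> c ->
          (label_seq r c t : seqlexi L) < label_seq r c' t].

Definition CL_labelling := prefix_compatible /\ rooted_interval_condition.

End Labelling.
End CLShellable.

Definition CL_shellable d (P : finTBPOrderType d) : Prop :=
  (forall m m' : seq P, maximal_chain m -> maximal_chain m' ->
     size m = size m') /\
  (exists (d' : Order.disp_t) (L : porderType d') (lam : seq P -> nat -> L),
     CL_labelling lam).

(** * Reduced homology of order complexes *)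

Section OrderComplex.
Context {d : Order.disp_t} {P : finPOrderType d}.
Variables (K : comNzRingType) (A : {set P}).

(** Simplices with [k] vertices, i.e. of dimension [k - 1], of the order complex
    of [A]; the vertices are listed increasingly, and [k = 0] gives the empty
    simplex. *)
Definition simplex k :=
  {s : k.-tuple P | sorted <%O s && all (fun z => z \in A) s}.

Definition simplex_seq k (s : simplex k) : seq P := val (val s).

Definition chains k := {ffun simplex k -> K}.

Definition delete_vertex i (s : seq P) := take i s ++ drop i.+1 s.

(** The simplicial boundary, augmentation included for [k = 1]; it is zero on
    [chains 0]. *)
Definition boundary k (f : chains k) : chains k.-1 :=
  [ffun t => (\sum_(s : simplex k)
     \sum_(i < k | delete_vertex i (simplex_seq s) == simplex_seq t)
       (-1) ^+ i * f s)%R].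

(** Vanishing of the reduced homology with coefficients in [K] in degree
    [k - 1]: cycles are boundaries. *)
Definition reduced_homology_vanishes k :=
  forall f : chains k, boundary f = 0%R ->
    exists g : chains k.+1, boundary g = f.

End OrderComplex.

Definition cohen_macaulay_over (K : comNzRingType) d (P : finPOrderType d) :=
  forall x y : P, x < y ->
  (* degree k - 1 differs from interval_length x y - 2 *)
  forall k, k.+1 <> interval_length x y ->
    reduced_homology_vanishes K (open_interval x y) k.

Definition cohen_macaulay d (P : finPOrderType d) : Prop :=
  cohen_macaulay_over int P /\
  (forall K : fieldType, cohen_macaulay_over K P).

(** * Pointed partitions of type B *)

(** [(i, false)] stands for [i + 1] and [(i, true)] for [- (i + 1)]. *)
Definition signed n : finType := ('I_n * bool)%type.

Section TypeB.
Context {n : nat}.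
Implicit Types (j : signed n) (S : {set signed n}).
Implicit Types (B : {set {set signed n}}) (E : {set signed n}).

Definition opp j : signed n := (j.1, ~~ j.2).
Definition opps S : {set signed n} := opp @: S.

Definition is_zero_block S := [exists j in S, opp j \in S].

Definition is_partitionB B :=
  [&& partition B [set: signed n],
      [forall S in B, forall S' in B,
         is_zero_block S ==> is_zero_block S' ==> (S == S')],
      [forall S in B, is_zero_block S ==> (opps S == S)]
    & [forall S in B, ~~ is_zero_block S ==> (opps S \in B)]].

(** The choice of pointed elements is encoded by their set [E]. *)
Definition is_pointing B E :=
  [forall S in B,
     (#|S :&: E| == 1)%N &&
     (~~ is_zero_block S ==> (opps S :&: E == opps (S :&: E)))].

Definition refines B B' := [forall S in B, exists S' in B', S \subset S'].

End TypeB.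

Record pointed_partitionB n := PointedPartitionB {
  blocks_points : {set {set signed n}} * {set signed n};
  _ : is_partitionB blocks_points.1 && is_pointing blocks_points.1 blocks_points.2
}.

Definition blocks n (p : pointed_partitionB n) := (blocks_points p).1.
Definition points n (p : pointed_partitionB n) := (blocks_points p).2.

HB.instance Definition _ n := [isSub for @blocks_points n].
HB.instance Definition _ n := [Finite of pointed_partitionB n by <:].

Section PointedPartitionBOrder.
Context {n : nat}.
Implicit Types p q : pointed_partitionB n.

Definition le_ppB p q := refines (blocks p) (blocks q) && (points q \subset points p).

Fact partition_blocks p : partition (blocks p) [set: signed n].
Proof. by have /andP[/and4P[]] := valP p. Qed.

Fact le_ppB_refl : reflexive le_ppB.
Proof.
move=> p; rewrite /le_ppB subxx andbT.
by apply/forall_inP => S pS; apply/exists_inP; exists S.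
Qed.

Fact refines_sub B B' : partition B [set: signed n] ->
  refines B B' -> refines B' B -> B \subset B'.
Proof.
case/and3P=> _ tB nB0 /forall_inP BB' /forall_inP B'B; apply/subsetP => S BS.
have /exists_inP[S' B'S' sSS'] := BB' _ BS.
have /exists_inP[S2 BS2 sS'S2] := B'B _ B'S'.
have sSS2 := subset_trans sSS' sS'S2.
have /set0Pn[j Sj] : S != set0 by apply: contraNneq nB0 => <-.
have eSS2 : S = S2.
  by rewrite -(def_pblock tB BS Sj) (def_pblock tB BS2 (subsetP sSS2 j Sj)).
suff -> : S = S' by [].
by apply/eqP; rewrite eqEsubset sSS' eSS2.
Qed.

Fact le_ppB_anti : antisymmetric le_ppB.
Proof.
move=> p q /andP[/andP[pq Eqp] /andP[qp Epq]]; apply/val_inj.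
rewrite [val p]surjective_pairing [val q]surjective_pairing; congr pair.
  by apply/eqP; rewrite eqEsubset !refines_sub ?partition_blocks.
by apply/eqP; rewrite eqEsubset Epq.
Qed.

Fact le_ppB_trans : transitive le_ppB.
Proof.
move=> q p r /andP[/forall_inP pq Eqp] /andP[/forall_inP qr Erq].
apply/andP; split; last exact: subset_trans Erq Eqp.
apply/forall_inP => S /pq /exists_inP[S' /qr /exists_inP[S2 rS2 sS'S2] sSS'].
by apply/exists_inP; exists S2 => //; apply: subset_trans sSS' sS'S2.
Qed.

End PointedPartitionBOrder.

Fact ppB_display : Order.disp_t. Proof. exact: Order.Disp tt tt. Qed.

HB.instance Definition _ n :=
  Order.Le_isPOrder.Build ppB_display (pointed_partitionB n)
    (@le_ppB_refl n) (@le_ppB_anti n) (@le_ppB_trans n).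

Section Bottom.
Context {n : nat}.

Definition singletons : {set {set signed n}} := [set [set j] | j : signed n].

Fact opps1 (j : signed n) : opps [set j] = [set opp j].
Proof. exact: imset_set1. Qed.

Fact zero_block1 (j : signed n) : is_zero_block [set j] = false.
Proof.
apply/negbTE/existsPn => k; rewrite !inE negb_and.
case: eqVneq => //= ->; case: j => i b.
by apply/eqP => -[]; case: b.
Qed.

Fact singletons_partition : partition singletons [set: signed n].
Proof.
apply/and3P; split.
- rewrite eqEsubset subsetT; apply/subsetP => j _.
  by apply/bigcupP; exists [set j]; rewrite ?inE ?imset_f.
- apply/trivIsetP => _ _ /imsetP[j _ ->] /imsetP[k _ ->] njk.
  by rewrite disjoints1 inE; apply: contraNneq njk => ->.
- by apply/imsetP => -[j _ /setP/(_ j)]; rewrite !inE eqxx.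
Qed.

Fact singletons_subproof :
  is_partitionB singletons && is_pointing singletons [set: signed n].
Proof.
apply/andP; split; last first.
  by apply/forall_inP => _ /imsetP[j _ ->]; rewrite !setIT cards1 !eqxx implybT.
apply/and4P; split; first exact: singletons_partition.
- apply/forall_inP => _ /imsetP[j _ ->]; apply/forall_inP => S' _.
  by rewrite zero_block1.
- by apply/forall_inP => _ /imsetP[j _ ->]; rewrite zero_block1.
- by apply/forall_inP => _ /imsetP[j _ ->]; rewrite opps1 imset_f ?implybT.
Qed.

Definition ppB_bottom : pointed_partitionB n :=
  @PointedPartitionB n (singletons, [set: signed n]) singletons_subproof.

Fact ppB_le0x (p : pointed_partitionB n) : ppB_bottom <= p.
Proof.
apply/andP; split; last exact: subsetT.
apply/forall_inP => _ /imsetP[j _ ->].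
have /and3P[/eqP cover_p _ _] := partition_blocks p.
have : j \in cover (blocks p) by rewrite cover_p.
case/bigcupP=> S pS Sj; apply/exists_inP; exists S => //.
by rewrite sub1set.
Qed.

End Bottom.

HB.instance Definition _ n :=
  Order.hasBottom.Build ppB_display (pointed_partitionB n) (@ppB_le0x n).

(** The interval [[\bot, a]], to be used with [a] maximal. *)
Definition PiB' n (a : pointed_partitionB n) : finTBPOrderType ppB_display :=
  closed_interval (le0x a).

(* Main.v *)
Require Import Defs.
From HB Require Import structures.
From mathcomp Require Import all_boot all_order all_algebra.
From mathcomp Require Import zify ring.

(** A pointed partition is encoded by the map sending every element to the
    pointed element of its block. These maps are the idempotent self-maps of the
    signed elements that are equivariant under negation except on the zero block
    ([retraction]), and [p <= q] becomes [q o p = q] and [p o q = q]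
    ([le_repr]). A cover of [x] affects one pair of opposite nonzero blocks:
    either it joins the pair to another nonzero pair and keeps one of the two
    points ([merge]), or it absorbs the pair into the zero block, which it
    creates if there is none ([grow]).

    The poset is not totally semimodular. Let [x] have no zero block, and let
    [S] (with point [s]) and [T] (with point [t]) be nonzero blocks of [x].
    The cover with the block [S u T] pointed at [s] and the cover with the block
    [S u -T] pointed at [t] may both lie below a [y] whose zero block contains
    [S] and [T] and is pointed in a third block; but an upper bound of them of
    rank two above [x] would need a zero block [S u T u -S u -T] pointed at
    [s] or [-s] and also at [t] or [-t]. What survives is that two covers of [x]
    below [y] have an upper bound [c <= y] of rank two above [x] as soon as both
    enlarge the zero block, or the zero block of [y] is that of [x]
    ([retr_exchange]).

    This suffices for a recursive atom ordering in the sense of Björner and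
    Wachs. The covers of [x] that enlarge the zero block come first; among those
    that do and among those that do not, a cover of [x] which, for the chosen
    chain to [x], lies above an earlier atom of the previous step precedes the
    others. If [b] does not enlarge the zero block but [y] does, then some
    enlarging cover precedes [b] and has a common cover with it below [y]
    ([key_exchange]). The atoms lying above earlier ones form an initial segment
    of the order ([initial_revisited]): after a step [a] that keeps the zero
    block, all enlarging covers of [a] lie above an enlarging cover of [x]; after
    a step that enlarges it, no other cover does. The axioms used are collected
    in [growth].

    The order gives integer labels whose increments are negative exactly at the
    atoms lying above earlier ones; the unique rising chain of an interval is the
    greedy one ([unique_rising]). For Cohen-Macaulayness, the open interval
    [(x, y)] is built up by adding the cones [[a, y)] one atom [a] at a time.
    The part of a cone that is already there consists of the elements of [(a, y)]
    above an initial segment of the atoms of [[a, y]], so it is a complex of the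
    same kind for a shorter interval, and a Mayer-Vietoris argument applies
    ([acyclic_above]). *)

Set Implicit Arguments.
Unset Strict Implicit.
Unset Printing Implicit Defensive.

Import Order.TTheory GRing.Theory Num.Theory.
Local Open Scope order_scope.

(** * Graded posets with a growing statistic *)

Section Growth.
Context {d : Order.disp_t} {P : finPOrderType d} {T : eqType}.
Implicit Types (x y a b : P).

(** [rho] is a rank function, and a value of [Z] (the zero block, below) never
    comes back on a chain once it has changed. Call a cover [a] of [x] growing if
    [Z a <> Z x].
    [growth_grow] says that growth can always be made the first step;
    [growth_indep] that, after a growing step, a step that is not growing cannot
    lead above another growing cover; [growth_exchange] is semimodularity,
    restricted to the two situations where it holds for pointed partitions. *)
Record growth (rho : P -> nat) (Z : P -> T) : Prop := Growth {
  growth_lt : forall x y, x < y -> (rho x < rho y)%N;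
  growth_step : forall x y, x < y ->
    exists k, [/\ x < k, k <= y & rho k = (rho x).+1];
  growth_mono : forall x y b, x <= y -> y <= b -> Z b = Z x -> Z y = Z x;
  growth_grow : forall x y, x <= y -> Z y <> Z x ->
    exists k, [/\ x < k, k <= y, rho k = (rho x).+1 & Z k <> Z x];
  growth_indep : forall x a b c, x < a -> x < b ->
    rho a = (rho x).+1 -> rho b = (rho x).+1 ->
    Z a <> Z x -> Z b <> Z x -> a <> b -> a <= c -> b <= c -> Z c <> Z a;
  growth_exchange : forall x a b y, x < a -> x < b ->
    rho a = (rho x).+1 -> rho b = (rho x).+1 -> a <> b -> a <= y -> b <= y ->
    (Z a <> Z x /\ Z b <> Z x) \/ Z y = Z x ->
    exists c, [/\ a <= c, b <= c, c <= y & rho c = (rho x).+2]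
}.

Variables (rho : P -> nat) (Z : P -> T).
Hypothesis gP : growth rho Z.

Lemma coversP x y : reflect (x < y /\ rho y = (rho x).+1) (covers x y).
Proof.
apply: (iffP andP) => [[xy /forallP mid]|[xy rxy]]; split=> //.
  have [k [xk ky rk]] := growth_step gP xy.
  have := mid k; rewrite xk /= => nky; move: ky; rewrite le_eqVlt (negbTE nky) orbF.
  by move/eqP=> <-.
apply/forallP => z; apply/negP => /andP[/(growth_lt gP) xz /(growth_lt gP) zy].
by move: xz zy; rewrite rxy; lia.
Qed.

Lemma covers_lt x y : covers x y -> x < y.
Proof. by case/andP. Qed.

Lemma covers_rho x y : covers x y -> rho y = (rho x).+1.
Proof. by case/coversP. Qed.

Lemma rho_le x y : x <= y -> (rho x <= rho y)%N.
Proof. by rewrite le_eqVlt => /predU1P[->//|/(growth_lt gP)/ltnW]. Qed.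

Lemma rho_inj_le x y : x <= y -> (rho y <= rho x)%N -> x = y.
Proof. by rewrite le_eqVlt => /predU1P[//|/(growth_lt gP)]; lia. Qed.

Lemma covers_exists x y : x < y -> exists2 k, covers x k & k <= y.
Proof.
by case/(growth_step gP) => k [xk ky rk]; exists k => //; apply/coversP.
Qed.

Lemma covers_exchange x a b y : covers x a -> covers x b -> a <> b ->
    a <= y -> b <= y -> (Z a <> Z x /\ Z b <> Z x) \/ Z y = Z x ->
  exists c, [/\ covers b c, a < c & c <= y].
Proof.
move=> /coversP[xa ra] /coversP[xb rb] nab ay byy H.
have [c [ac bc cy rc]] := growth_exchange gP xa xb ra rb nab ay byy H.
exists c; split=> //.
  apply/coversP; split; last by lia.
  by rewrite lt_neqAle bc andbT; apply/eqP => e; move: rc; rewrite -e; lia.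
by rewrite lt_neqAle ac andbT; apply/eqP => e; move: rc; rewrite -e; lia.
Qed.

Lemma saturated_size x y c : saturated x y c -> (size c + rho x = rho y)%N.
Proof.
elim: c x => [|a c IH] x /andP[/=]; first by move=> _ /eqP->.
case/andP=> xa ac ac'; have := IH a; rewrite /saturated ac ac' => /(_ isT).
by rewrite (covers_rho xa); lia.
Qed.

Lemma saturated_le x y c : saturated x y c -> x <= y.
Proof.
elim: c x => [|a c IH] x /andP[/=]; first by move=> _ /eqP->.
case/andP=> xa ac ac'; apply: le_trans (ltW (covers_lt xa)) _.
by apply: IH; rewrite /saturated ac ac'.
Qed.

Lemma saturated_cons x y a c :
  saturated x y (a :: c) = covers x a && saturated a y c.
Proof. by rewrite /saturated /= andbA. Qed.

(** * The recursive atom ordering *)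

Implicit Types F : {set P}.

(** The order of the covers of [x]: growing ones first, within each kind those in
    [F] first, ties being broken arbitrarily. [F] depends on the chain leading to [x], see
    [revisited]. *)
Definition key x F a : nat :=
  (((Z a == Z x).*2 + (a \notin F)) * #|P| + enum_rank a)%N.

Definition earlier x F a : pred P :=
  [pred k | covers x k && (key x F k < key x F a)%N].

(** The covers of [a] that a recursive atom ordering has to list first after the
    step from [x] to [a]. *)
Definition revisited x F a : {set P} :=
  [set b | covers a b & [exists k, earlier x F a k && (k < b)]].

Definition initial x F := forall b b', covers x b -> covers x b' ->
  b \in F -> b' \notin F -> (key x F b < key x F b')%N.

Lemma key_digits x F a : exists i N,
  [/\ #|P| = N, (i < N)%N &
      key x F a = ((Z a == Z x).*2 + (a \notin F)) * N + i]%N.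
Proof. by exists (enum_rank a), #|P|; split=> //; apply: ltn_ord. Qed.

Lemma key_lt x F a : (key x F a < 4 * #|P|)%N.
Proof.
have [i [N [-> iN ->]]] := key_digits x F a.
by case: eqP; case: (_ \notin _) => _ /=; lia.
Qed.

Lemma key_inj x F : injective (key x F).
Proof.
move=> a b; rewrite /key => e; apply: enum_rank_inj; apply: val_inj => /=.
move/(congr1 (modn^~ #|P|)): e; rewrite !modnMDl !modn_small //.
Qed.

Lemma key_grow x F a b : Z a <> Z x -> Z b = Z x -> (key x F a < key x F b)%N.
Proof.
move=> na eb; have [i [N [eN iN ->]]] := key_digits x F a.
have [j [N' [eN' jN ->]]] := key_digits x F b; rewrite eN in eN'; subst N'.
rewrite eb eqxx; move/eqP/negbTE: na => ->.
by case: (a \notin F); case: (_ \notin _) => /=; lia.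
Qed.

Lemma key_grow_le x F a b :
  Z a <> Z x -> (key x F b < key x F a)%N -> Z b <> Z x.
Proof. by move=> na lt e; have := key_grow F na e; lia. Qed.

Lemma key_visited x F a b :
  (Z b = Z x -> Z a = Z x) -> b \in F -> a \notin F -> (key x F b < key x F a)%N.
Proof.
move=> h bF aF; have [i [N [eN iN ->]]] := key_digits x F a.
have [j [N' [eN' jN ->]]] := key_digits x F b; rewrite eN in eN'; subst N'.
by rewrite bF aF; case: (Z b =P Z x) => [/h->|_]; rewrite ?eqxx; case: (Z a == Z x) => /=; lia.
Qed.

(** If [a] is not growing, then by [growth_grow] every growing cover of [a] is
    above a growing cover of [x], which precedes [a]: all of them are revisited.
    If [a] is growing, then the covers of [x] that precede it are growing too,
    and by [growth_indep] only growing covers of [a] are revisited. In both cases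
    growth, the first criterion of [key], does not conflict with
    revisitedness. *)
Lemma initial_revisited x F a :
  covers x a -> initial a (revisited x F a).
Proof.
move=> xa b b' ab ab' bF b'F; apply: key_visited => // Zb; apply/eqP/negPn/negP.
move=> /eqP Zb'; move/negP: b'F; apply.
have [Zax|Zax] := eqVneq (Z a) (Z x).
  have xb' : x <= b' by apply: ltW (lt_trans (covers_lt xa) (covers_lt ab')).
  rewrite Zax in Zb'; have [k [xk kb' rk Zk]] := growth_grow gP xb' Zb'.
  rewrite inE ab'; apply/existsP; exists k; apply/andP; split.
    by apply/andP; split; [apply/coversP | apply: key_grow].
  rewrite lt_neqAle kb' andbT; apply/eqP => e.
  by have := covers_rho ab'; rewrite -e rk (covers_rho xa); lia.
move: bF; rewrite inE => /andP[_ /existsP[k /andP[/andP[xk ka] kb]]].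
case: (growth_indep gP (covers_lt xa) (covers_lt xk) (covers_rho xa)
  (covers_rho xk) _ _ _ (ltW (covers_lt ab)) (ltW kb) Zb).
- exact/eqP.
- exact: key_grow_le (elimN eqP Zax) ka.
- by move=> e; rewrite e ltnn in ka.
Qed.

(** The second condition of a recursive atom ordering. When [b] is not growing
    but [y] is, the given cover [a] may have no common cover with [b] below [y];
    it is replaced by a growing cover [k] of [x], found below a growing cover [c]
    of [b]. *)
Lemma key_exchange x F a b y : covers x a -> covers x b -> a <= y -> b <= y ->
  (key x F a < key x F b)%N ->
  exists c, c \in revisited x F b /\ c <= y.
Proof.
move=> xa xb ay byy ab.
have nab : a <> b by move=> e; rewrite e ltnn in ab.
have aux k : covers x k -> (key x F k < key x F b)%N -> k <= y ->
    (Z k <> Z x /\ Z b <> Z x) \/ Z y = Z x ->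
    exists c, c \in revisited x F b /\ c <= y.
  move=> xk kb ky H; have nkb : k <> b by move=> e; rewrite e ltnn in kb.
  have [c [bc kc cy]] := covers_exchange xk xb nkb ky byy H.
  by exists c; rewrite inE bc; split=> //; apply/existsP; exists k; rewrite /earlier /= xk kb.
have [Zb|/eqP Zb] := eqVneq (Z b) (Z x); last first.
  by apply: (aux a) => //; left; split=> //; apply: key_grow_le ab.
have [Zy|/eqP Zy] := eqVneq (Z y) (Z x); first by apply: (aux a) => //; right.
rewrite -Zb in Zy; have [c [bc cy rc Zc]] := growth_grow gP byy Zy.
rewrite Zb in Zc.
have [k [xk kc rk Zk]] := growth_grow gP (ltW (lt_trans (covers_lt xb) bc)) Zc.
exists c; split=> //; rewrite inE; apply/andP; split; first exact/coversP.
apply/existsP; exists k; apply/andP; split.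
  by apply/andP; split; [apply/coversP | apply: key_grow].
rewrite lt_neqAle kc andbT; apply/eqP => e.
by have := covers_rho xb; rewrite -e in rc; lia.
Qed.

(** * The labelling *)

(** Strictly increasing in [key], and positive exactly outside [F]. The bound
    [4 * #|P|] exceeds every key. *)
Definition increment x F b : int :=
  if b \in F then ((key x F b)%:Z - (4 * #|P|)%N%:Z)%R else (key x F b).+1%:Z%R.

(** The labels of the chain [c] starting at [x], where [F] and the last label [l]
    summarize the chain leading to [x]. *)
Fixpoint labels x F (l : int) (c : seq P) : seq int :=
  if c is b :: c' then
    let l' := (l + increment x F b)%R in l' :: labels b (revisited x F b) l' c'
  else [::].

Lemma size_labels x F l c : size (labels x F l c) = size c.
Proof. by elim: c x F l => //= b c IH x F l; rewrite IH. Qed.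

Lemma take_labels x F l c k : take k (labels x F l c) = labels x F l (take k c).
Proof. by elim: c x F l k => [|b c IH] x F l [|k] //=; rewrite IH. Qed.

(** A root influences the labels above it only through a set of revisited covers
    and a last label. *)
Lemma labels_cat x F l r y : saturated x y r -> initial x F ->
  exists G l', initial y G /\
    forall c, labels x F l (r ++ c) = labels x F l r ++ labels y G l' c.
Proof.
elim: r x F l => [|b r IH] x F l.
  by move=> /andP[_ /eqP <-] iF; exists F, l.
rewrite saturated_cons => /andP[xb br] iF.
have [G [l' [iG E]]] := IH _ _ (l + increment x F b)%R br (initial_revisited (F := F) xb).
by exists G, l'; split=> // c /=; rewrite E.
Qed.

Lemma increment_gt0 x F b : (0 < increment x F b)%R = (b \notin F).
Proof.
rewrite /increment; case: ifP => _ //.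
by apply/negbTE; move: (4 * _)%N (key_lt x F b) => N; lia.
Qed.

Lemma increment_lt x F a b : initial x F -> covers x a -> covers x b ->
  (key x F a < key x F b)%N -> (increment x F a < increment x F b)%R.
Proof.
move=> iF xa xb ab; rewrite /increment.
move: (4 * _)%N (key_lt x F a) => N aN.
case: ifP => aF; case: ifP => bF; try lia.
by have := iF _ _ xb xa bF (negbT aF); lia.
Qed.

Lemma sorted_labels_cons x F l a b c :
  sorted <%O (labels x F l (a :: b :: c)) =
  (b \notin revisited x F a) &&
  sorted <%O (labels a (revisited x F a) (l + increment x F a)%R (b :: c)).
Proof. by rewrite /= ltrDl increment_gt0. Qed.

(** The rising chain always takes the first cover below [y]; it never steps into
    a revisited cover, for that would lie above an earlier cover below [y]. A
    chain starting with another cover [b] is not rising: by [key_exchange] some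
    revisited cover of [b] is below [y], so the first cover of [b] below [y] is
    revisited, but by induction a rising chain has to continue with it. *)
Lemma unique_rising x y F l : x <= y -> initial x F ->
  exists c,
    [/\ saturated x y c,
        sorted <%O (labels x F l c),
        forall b, covers x b -> b <= y -> (key x F (head x c) <= key x F b)%N,
        forall c', saturated x y c' -> sorted <%O (labels x F l c') -> c' = c
      & forall c', saturated x y c' -> c' <> c ->
          (labels x F l c : seqlexi int) < labels x F l c'].
Proof.
have [n] := ubnP (rho y - rho x); elim: n x F l => // n IH x F l le_n xy iF.
move: xy; rewrite le_eqVlt => /predU1P[<-|xy].
  have nil c' : saturated x x c' -> c' = [::].
    by move/saturated_size => h; apply: size0nil; lia.
  exists [::]; split=> // [||c' /nil->//|c' /nil->//]; first by rewrite /saturated /= eqxx.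
  by move=> b xb bx; have := lt_geF (covers_lt xb); rewrite bx.
have [a0 xa0 a0y] := covers_exists xy.
have h0 : covers x a0 && (a0 <= y) by rewrite xa0.
have [a [xa ay amin]] : exists a, [/\ covers x a, a <= y &
    forall b, covers x b -> b <= y -> (key x F a <= key x F b)%N].
  case: (@arg_minnP _ a0 (fun a => covers x a && (a <= y)) (key x F) h0) => a /andP[xa ay] mina; exists a; split=> //.
  by move=> b xb byy; apply: mina; rewrite xb.
have rest b (xb : covers x b) (byy : b <= y) :
    [/\ (rho y - rho b < n)%N & initial b (revisited x F b)].
  split; last exact: initial_revisited.
  by have := covers_rho xb; have := rho_le byy; lia.
have [ra ia] := rest a xa ay.
have [c [sc lc mc uc xc]] := IH a _ (l + increment x F a)%R ra ay ia.
have nc b : covers a b -> b <= y -> b \notin revisited x F a.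
  move=> ab byy; rewrite inE ab /=; apply/existsPn => k.
  apply/negP => /andP[/andP[xk ka] kb].
  by rewrite ltnNge (amin _ xk (le_trans (ltW kb) byy)) in ka.
exists (a :: c); split=> //.
- by rewrite saturated_cons xa.
- case: c sc lc {mc uc xc} => [//|b c] sc lc; rewrite sorted_labels_cons lc andbT.
  by move: sc; rewrite saturated_cons => /andP[ab /saturated_le byy]; apply: nc.
- case=> [|b c']; first by move=> /andP[_ /eqP /= e]; rewrite e ltxx in xy.
  rewrite saturated_cons => /andP[xb sc'] lc'.
  have byy := saturated_le sc'; have [eb|nb] := eqVneq b a.
    by subst b; congr cons; apply: uc => //; apply: path_sorted lc'.
  have ab : (key x F a < key x F b)%N.
    rewrite ltn_neqAle amin // andbT; apply: contraNneq nb => e.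
    exact/eqP/esym/(key_inj e).
  have [rb ib] := rest b xb byy.
  have [e [se le me ue _]] := IH b _ (l + increment x F b)%R rb byy ib.
  have lc'' : sorted <%O (labels b (revisited x F b) (l + increment x F b)%R c').
    exact: path_sorted lc'.
  have ec := ue _ sc' lc''; subst e.
  have [z [zF zy]] := key_exchange xa xb ay byy ab.
  have bz : covers b z by move: zF; rewrite inE => /andP[].
  case: c' {ue} lc' sc' lc'' se le me => [|b' c'].
    move=> _ /andP[_ /eqP /= e]; subst y.
    by have := lt_geF (covers_lt bz); rewrite zy.
  rewrite sorted_labels_cons => /andP[b'F _] + _ _ _ me.
  rewrite saturated_cons => /andP[bb' _].
  by have := ib _ _ bz bb' zF b'F; rewrite ltnNge (me _ bz zy).
- case=> [|b c']; first by move=> /andP[_ /eqP /= e]; rewrite e ltxx in xy.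
  rewrite saturated_cons => /andP[xb sc'] nc'.
  have byy := saturated_le sc'; have [eb|nb] := eqVneq b a.
    subst b; rewrite /= eqhead_ltxiE; apply: xc => // e; apply: nc'.
    by rewrite e.
  have ab : (key x F a < key x F b)%N.
    rewrite ltn_neqAle amin // andbT; apply: contraNneq nb => e.
    exact/eqP/esym/(key_inj e).
  have lt : (l + increment x F a < l + increment x F b)%R.
    by rewrite ltrD2l increment_lt.
  by rewrite /= neqhead_ltxiE ?lt // lt_eqF.
Qed.

End Growth.

Lemma growth_CL_shellable d (P : finTBPOrderType d) (T : eqType)
  (rho : P -> nat) (Z : P -> T) : growth rho Z -> CL_shellable P.
Proof.
move=> gP; split.
  move=> m m' /(saturated_size gP) h /(saturated_size gP) h'.
  by apply: (@addIn (rho \bot)); rewrite h h'.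
pose lam m i := nth 0%R (labels Z \bot set0 0%R m) i.
have i0 : initial Z (\bot : P) set0 by move=> b b' _ _; rewrite inE.
exists _, int, lam; split.
  move=> m m' k sm sm' e i ik; rewrite /lam -[LHS](nth_take _ ik).
  by rewrite -[RHS](nth_take _ ik) !take_labels e.
move=> x y r t xy sr st.
have [G [l [iG E]]] := labels_cat gP 0%R sr i0.
have lamE c : saturated x y c -> label_seq lam r c t = labels Z x G l c.
  move=> sc; have [G' [l' [_ E']]] := labels_cat gP l sc iG.
  rewrite /label_seq /lam E E' map_nth_iota.
    rewrite drop_size_cat ?size_labels //.
    by rewrite take_size_cat ?size_labels.
  by rewrite size_cat size_labels addKn size_cat size_labels leq_addr.
have [c [sc lc _ uc xc]] := unique_rising gP l xy iG.
exists c; split=> // [|c' sc'|c' sc' nc'].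
- by rewrite lamE.
- by rewrite lamE //; apply: uc.
- by rewrite !lamE //; apply: xc.
Qed.

(** * Chain complexes of sets of a finite poset *)

Section Homology.
Context {d : Order.disp_t} {P : finPOrderType d} (K : comNzRingType).
Local Open Scope ring_scope.
Implicit Types (s t u : seq P) (G H : seq P -> K) (A B C : {pred P}).

(** The simplicial coboundary, on functions on sequences: the alternating sum of
    [G] over the faces of [s]. The recursion makes [faces_faces] and the cone
    construction immediate, and boundaries are handled by duality with it. *)
Fixpoint faces G s : K :=
  if s is v :: s' then G s' - faces (fun w => G (v :: w)) s' else 0.

Lemma eq_faces G H s :
    (forall t, subseq t s -> (size t).+1 = size s -> G t = H t) ->
  faces G s = faces H s.
Proof.
elim: s G H => [//|v s IH] G H E /=.
congr (_ - _); first by apply: E => //; apply: subseq_cons.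
by apply: IH => t ts et; apply: E; rewrite /= ?et ?eqxx.
Qed.

Lemma facesB G H s : faces (fun t => G t - H t) s = faces G s - faces H s.
Proof.
elim: s G H => [|v s IH] G H /=; first by rewrite subr0.
by rewrite IH; ring.
Qed.

Lemma faces_sum (I : finType) (c : I -> K) (G : I -> seq P -> K) s :
  faces (fun t => \sum_i c i * G i t) s = \sum_i c i * faces (G i) s.
Proof.
elim: s G => [|v s IH] G /=; first by rewrite big1 // => i _; rewrite mulr0.
by rewrite IH -sumrB; apply: eq_bigr => i _; rewrite mulrBr.
Qed.

(** The coboundary of [v :: s] is that of [s] minus the one relative to [v], so
    the two remaining terms of the double coboundary cancel. *)
Lemma faces_faces G s : faces (faces G) s = 0.
Proof.
elim: s G => //= v s IH G; rewrite (@facesB G) IH subr0; exact: subrr.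
Qed.

Lemma facesE G s : faces G s = \sum_(i < size s) (-1) ^+ i * G (delete_vertex i s).
Proof.
elim: s G => [|v s IH] G /=; first by rewrite big_ord0.
rewrite big_ord_recl /= expr0 mul1r /delete_vertex /= drop0; congr (_ + _).
rewrite IH -sumrN; apply: eq_bigr => i _.
by rewrite exprS mulN1r mulNr.
Qed.

Lemma faces_support G s : faces G s != 0 -> exists2 t, subseq t s & G t != 0.
Proof.
elim: s G => [|v s IH] G /=; first by rewrite eqxx.
have [->|Gs _] := eqVneq (G s) 0; last by exists s => //; apply: subseq_cons.
rewrite sub0r oppr_eq0 => /IH[t ts Gt]; exists (v :: t) => //=.
by rewrite eqxx.
Qed.

Local Notation chain k := {ffun k.-tuple P -> K}.

Definition pairing k (f : chain k) G := \sum_s f s * G s.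

Definition chain_in A s := sorted <%O s && all (mem A) s.

Definition supported A k (f : chain k) := forall s : k.-tuple P, f s != 0 -> chain_in A s.

(** The boundary of [f] vanishes. This form also covers [k = 0], where there is no
    condition. *)
Definition cycle k (f : chain k) := forall G, pairing f (faces G) = 0.

(** The boundary of [g] is [f]. *)
Definition bounds k (g : chain k.+1) (f : chain k) :=
  forall G, pairing g (faces G) = pairing f G.

Definition acyclic A k := forall f : chain k,
  supported A f -> cycle f -> exists2 g, supported A g & bounds g f.

Lemma pairingD k (f g : chain k) G :
  pairing (f + g) G = pairing f G + pairing g G.
Proof. by rewrite -big_split; apply: eq_bigr => s _; rewrite ffunE mulrDl. Qed.

Lemma pairingB k (f g : chain k) G :
  pairing (f - g) G = pairing f G - pairing g G.
Proof. by rewrite -sumrB; apply: eq_bigr => s _; rewrite !ffunE mulrBl. Qed.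

Lemma pairing0 k G : pairing (0 : chain k) G = 0.
Proof. by rewrite /pairing big1 // => s _; rewrite ffunE mul0r. Qed.

Lemma pairing_subr k (f : chain k) G H :
  pairing f (fun s => G s - H s) = pairing f G - pairing f H.
Proof. by rewrite -sumrB; apply: eq_bigr => s _; rewrite mulrBr. Qed.

Lemma eq_pairing k (f : chain k) G H :
  (forall s : k.-tuple P, f s != 0 -> G s = H s) -> pairing f G = pairing f H.
Proof.
move=> E; apply: eq_bigr => s _.
by have [->|/E->//] := eqVneq (f s) 0; rewrite !mul0r.
Qed.

Lemma pairing_neq0 k (f : chain k) G :
  pairing f G != 0 -> exists2 s : k.-tuple P, f s != 0 & G s != 0.
Proof.
move=> n0.
suff /existsP[s /andP[fs Gs]] : [exists s : k.-tuple P, (f s != 0) && (G s != 0)].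
  by exists s.
apply: contraNT n0 => /existsPn E; rewrite /pairing big1 // => s _.
by have := E s; rewrite negb_and !negbK => /orP[]/eqP->; rewrite ?mul0r ?mulr0.
Qed.

Lemma supportedD A k (f g : chain k) :
  supported A f -> supported A g -> supported A (f + g).
Proof.
move=> fA gA s; rewrite ffunE => n0.
have [f0|/fA//] := eqVneq (f s) 0; apply: gA.
by move: n0; rewrite f0 add0r.
Qed.

Lemma supportedB A k (f g : chain k) :
  supported A f -> supported A g -> supported A (f - g).
Proof.
move=> fA gA s; rewrite !ffunE => n0.
have [f0|/fA//] := eqVneq (f s) 0; apply: gA.
by move: n0; rewrite f0 sub0r oppr_eq0.
Qed.

Lemma supported0 A k : supported A (0 : chain k).
Proof. by move=> s; rewrite ffunE eqxx. Qed.

Lemma sub_supported A B k (f : chain k) :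
  (forall x, x \in A -> x \in B) -> supported A f -> supported B f.
Proof.
move=> AB fA s /fA/andP[ss sA]; rewrite /chain_in ss.
by apply: sub_all sA => x; apply: AB.
Qed.

Lemma chain_in_subseq A s t : subseq t s -> chain_in A s -> chain_in A t.
Proof.
move=> ts /andP[ss sA]; apply/andP; split.
  exact: subseq_sorted (@lt_trans _ P) _ _ ts ss.
by apply/allP => x /(mem_subseq ts); apply/allP.
Qed.

Definition indic t : seq P -> K := fun s => (s == t)%:R.

Definition bd k (f : chain k.+1) : chain k :=
  [ffun t : k.-tuple P => pairing f (faces (indic t))].

Lemma bdP k (f : chain k.+1) : bounds f (bd f).
Proof.
move=> G; rewrite /pairing.
transitivity (\sum_(t : k.-tuple P) \sum_s f s * faces (indic (tval t)) s * G (tval t)).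
  rewrite exchange_big /=; apply: eq_bigr => s _.
  under eq_bigr do rewrite -mulrA.
  rewrite -mulr_sumr; congr (_ * _).
  under eq_bigr do rewrite mulrC.
  rewrite -faces_sum; apply: eq_faces => t _; rewrite size_tuple => -[et].
  pose t' := Tuple (introT eqP et); rewrite (bigD1 t') //= /indic eqxx mulr1.
  rewrite big1 ?addr0 // => u; rewrite -val_eqE /= eq_sym => /negbTE->.
  by rewrite mulr0.
by apply: eq_bigr => t _; rewrite ffunE mulr_suml.
Qed.

Lemma bd_supported A k (f : chain k.+1) : supported A f -> supported A (bd f).
Proof.
move=> fA t; rewrite ffunE => /pairing_neq0[s /fA sA /faces_support[u us]].
rewrite /indic; have [<- _|] := eqVneq u (val t); last by rewrite eqxx.
exact: chain_in_subseq us sA.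
Qed.

Lemma cycle_bd k (f : chain k.+1) : cycle (bd f).
Proof.
move=> G; rewrite -bdP /pairing big1 // => s _.
by rewrite faces_faces mulr0.
Qed.

Lemma bdB k (f g : chain k.+1) : bd (f - g) = bd f - bd g.
Proof. by apply/ffunP => t; rewrite !ffunE pairingB. Qed.

Lemma cycle_bd0 k (f : chain k.+1) : cycle f -> bd f = 0.
Proof. by move=> fc; apply/ffunP => t; rewrite !ffunE fc. Qed.

Definition restrict k (p : pred (seq P)) (f : chain k) : chain k :=
  [ffun s : k.-tuple P => if p s then f s else 0].

Lemma restrict_neq0 k p (f : chain k) (s : k.-tuple P) :
  restrict p f s != 0 -> p s /\ f s != 0.
Proof. by rewrite ffunE; case: ifP => //; rewrite eqxx. Qed.

(** The cone over [f] with apex [a]. *)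
Definition join a k (f : chain k) : chain k.+1 :=
  [ffun u : k.+1.-tuple P => if thead u == a then f (behead_tuple u) else 0].

Lemma pairing_join a k (f : chain k) G :
  pairing (join a f) G = pairing f (fun s => G (a :: s)).
Proof.
rewrite /pairing (bigID (fun u : k.+1.-tuple P => thead u == a)) /= [X in _ + X]big1 ?addr0.
  rewrite (reindex_onto (fun s : k.-tuple P => [tuple of a :: s])
             (fun u : k.+1.-tuple P => behead_tuple u)) /=; last first.
    move=> u /eqP <-; apply: val_inj => /=.
    by case: u => -[|v u] //= iu; rewrite /thead (tnth_nth v).
  apply: eq_big => [s|s _].
    rewrite theadE eqxx /=; apply/eqP/val_inj => //.
  rewrite ffunE theadE eqxx; congr (f _ * _); exact: val_inj.
by move=> u /negbTE na; rewrite ffunE na mul0r.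
Qed.

(** Write [f] as [f0 + f1], where [f0] avoids [a] and the simplices of [f1]
    contain it. Comparing, in the boundary of [f], the simplices without [a]
    expresses [f1] through the boundary of [f0]; this makes the cone over [f0]
    bound [f]. *)
Lemma acyclic_cone a A k : a \in A -> (forall x, x \in A -> (a <= x)%O) ->
  acyclic A k.
Proof.
move=> Aa Age f fA fc.
pose f0 := restrict (fun s => a \notin s) f.
have amem s : chain_in A s -> a \in s -> exists2 w, s = a :: w & a \notin w.
  case: s => // v w /andP[/= vw /andP[Av Aw]].
  have vmin := order_path_min (@lt_trans _ P) vw.
  rewrite inE => /predU1P[->|aw].
    by exists w => //; apply/negP => /(allP vmin); rewrite /= ltxx.
  by have := lt_geF (allP vmin _ aw); rewrite Age.
exists (join a f0).
  move=> u; rewrite ffunE; case: (thead u =P a) => [ea|_]; last by rewrite eqxx.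
  rewrite [f0 _]ffunE; case: ifP => [na /fA|_]; last by rewrite eqxx.
  have eu : tval u = a :: behead u by rewrite -ea; case: (tupleP u) => v w /=; rewrite theadE.
  rewrite eu; move: na; rewrite /=; move: (behead u) => w na.
  move=> /andP[sw wA]; apply/andP; split; last by rewrite /= wA andbT.
  case: w na sw wA => //= v w; rewrite inE negb_or => /andP[va _] -> /andP[Av _].
  by rewrite andbT lt_neqAle va Age.
move=> G.
rewrite pairing_join /= pairing_subr.
(* Pairing the cycle [f] with the coboundary of [G'] isolates the simplices
   without [a] in its boundary. *)
pose G' u := if a \in u then 0 else G (a :: u).
have split_f H : pairing f H = pairing (f - f0) H + pairing f0 H.
  by rewrite -pairingD subrK.
have := fc G'; rewrite !split_f => e.
rewrite [LHS]addrC; congr (_ + _); move/eqP: e; rewrite addr_eq0 => /eqP e.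
rewrite (_ : pairing f0 (faces (fun w => G (a :: w))) = pairing f0 (faces G')).
  rewrite -e; apply: eq_pairing => s; rewrite !ffunE.
  case: ifP => [|/negbFE sa]; first by rewrite subrr eqxx.
  rewrite subr0 => /fA/amem/(_ sa)[w -> aw] /=.
  rewrite /G' (negbTE aw) -[RHS]subr0; congr (_ - _).
  rewrite (eq_faces (H := fun=> 0 - 0)) => [|t _ _]; last by rewrite subrr inE eqxx.
  by rewrite (@facesB (fun=> 0)) subrr.
apply: eq_pairing => s; rewrite ffunE; case: ifP => [sa _|_]; last by rewrite eqxx.
apply: eq_faces => t ts _; rewrite /G' ifN //.
by apply: contra sa; apply: mem_subseq.
Qed.

(** Mayer-Vietoris. The part [f2] of a cycle [f] in [C] has its boundary both in
    [B] and in [C]; a chain [g] of the intersection with the same boundary turns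
    [f] into the sum of the cycles [f - f2 + g] of [B] and [f2 - g] of [C]. *)
Lemma acyclic_union A B C k :
    (forall s, chain_in A s -> chain_in B s || chain_in C s) ->
    (forall x, x \in B -> x \in A) -> (forall x, x \in C -> x \in A) ->
    acyclic B k -> acyclic C k ->
    (0 < k -> acyclic [predI B & C] k.-1)%N -> acyclic A k.
Proof.
move=> AE BA CA Bk Ck BCk f fA fc.
pose f2 := restrict (chain_in C) f; pose f1 := f - f2.
have f2C : supported C f2 by move=> s /restrict_neq0[].
have f1B : supported B f1.
  move=> s; rewrite !ffunE; case: ifP => sC; first by rewrite subrr eqxx.
  by rewrite subr0 => /fA/AE; rewrite sC orbF.
have [g [gB gC gf]] : exists g : chain k,
    [/\ supported B g, supported C g & forall G, pairing g (faces G) = pairing f2 (faces G)].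
  case: k BCk Bk Ck f fA fc @f2 @f1 f2C f1B => [|k] BCk Bk Ck f fA fc f2 f1 f2C f1B.
    (* For [k = 0] the only simplex is the empty one, without boundary. *)
    exists 0; split; try exact: supported0.
    move=> G; rewrite pairing0 /pairing big1 // => s _.
    by rewrite (tuple0 s) mulr0.
  have [] := BCk isT (bd f2).
  - have e : bd f2 = - bd f1 by rewrite bdB (cycle_bd0 fc) sub0r opprK.
    move=> t t0; have /andP[st tC] := bd_supported f2C t0.
    have /(bd_supported f1B)/andP[_ tB] : bd f1 t != 0.
      by move: t0; rewrite e ffunE oppr_eq0.
    apply/andP; split=> //.
    by apply/allP => x xt; apply/andP; split; [apply: (allP tB)|apply: (allP tC)].
  - exact: cycle_bd.
  move=> g gBC gb; exists g; split; last by move=> G; rewrite gb -bdP.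
    by apply: sub_supported gBC => x /andP[].
  by apply: sub_supported gBC => x /andP[].
have [||g1 g1B b1] := Bk (f1 + g); first exact: supportedD.
  by move=> G; rewrite pairingD gf -pairingD subrK fc.
have [||g2 g2C b2] := Ck (f2 - g); first exact: supportedB.
  by move=> G; rewrite pairingB gf subrr.
exists (g1 + g2).
  by apply: supportedD; [apply: sub_supported g1B|apply: sub_supported g2C].
by move=> G; rewrite pairingD b1 b2 -pairingD addrACA subrr addr0 subrK.
Qed.

Lemma acyclic_eq A B k : A =i B -> acyclic A k -> acyclic B k.
Proof.
move=> AB Ak f fB fc; have [|g gA gf] := Ak f _ fc.
  by apply: sub_supported fB => x; rewrite AB.
by exists g => //; apply: sub_supported gA => x; rewrite AB.
Qed.

Lemma acyclic_void A k : (forall s, chain_in A s -> size s <> k) -> acyclic A k.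
Proof.
move=> void f fA _; exists 0; first exact: supported0.
move=> G; rewrite pairing0 /pairing big1 // => s _.
have [->|/fA/void] := eqVneq (f s) 0; first by rewrite mul0r.
by rewrite size_tuple.
Qed.

Section Simplex.
Variable A : {set P}.

Definition simplex_tuple k (s : simplex A k) : k.-tuple P := val s.

Definition extend k (f : chains K A k) : chain k :=
  [ffun t => \sum_(s | simplex_tuple s == t) f s].

Lemma extend_val k (f : chains K A k) (s : simplex A k) : extend f (simplex_tuple s) = f s.
Proof.
rewrite ffunE (bigD1 s) //= big1 ?addr0 // => u /andP[/eqP/val_inj->].
by rewrite eqxx.
Qed.

Lemma extend_supported k (f : chains K A k) : supported (mem A) (extend f).
Proof.
move=> t; have [tA //|tA] := boolP (chain_in (mem A) t).
rewrite ffunE big1 ?eqxx // => s /eqP e; move/negP: tA; case.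
by rewrite -e; apply: (valP s).
Qed.

Lemma extend_restrict k (g : chain k) : supported (mem A) g ->
  extend [ffun s => g (simplex_tuple s)] = g.
Proof.
move=> gA; apply/ffunP => t; have [tA|tA] := boolP (chain_in (mem A) t).
  by have -> : t = simplex_tuple (Sub t tA) by []; rewrite extend_val ffunE.
have out (h : chain k) : supported (mem A) h -> h t = 0.
  by move=> hA; apply/eqP; apply: contraNT tA => /hA.
by rewrite !out //; apply: extend_supported.
Qed.

Lemma pairing_extend k (f : chains K A k) G :
  pairing (extend f) G = \sum_s f s * G (simplex_seq s).
Proof.
rewrite (partition_big (@simplex_tuple k) predT) //=; apply: eq_bigr => t _.
by rewrite ffunE mulr_suml; apply: eq_bigr => s /eqP <-.
Qed.

Lemma boundaryE k (f : chains K A k) (t : simplex A k.-1) :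
  boundary f t = pairing (extend f) (faces (indic (simplex_seq t))).
Proof.
rewrite pairing_extend ffunE; apply: eq_bigr => s _.
rewrite facesE size_tuple mulr_sumr big_mkcond; apply: eq_bigr => i _.
by rewrite /indic; case: eqP => _; rewrite ?mulr1 ?mulr0 // mulrC.
Qed.

Lemma pairing_indic k (f : chain k) (t : k.-tuple P) : pairing f (indic t) = f t.
Proof.
rewrite /pairing (bigD1 t) //= /indic eqxx mulr1 big1 ?addr0 // => u.
by rewrite -val_eqE /= => /negbTE->; rewrite mulr0.
Qed.

(** Chains of [A] extended by zero have the same boundary. *)
Lemma acyclic_homology k : acyclic (mem A) k -> reduced_homology_vanishes K A k.
Proof.
move=> Ak f f0; have [||g gA gf] := Ak (extend f); first exact: extend_supported.
  case: k {Ak} f f0 => [|k] f f0 G.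
    by rewrite /pairing big1 // => s _; rewrite (tuple0 s) mulr0.
  rewrite bdP (_ : bd (extend f) = 0) ?pairing0 //; apply/ffunP => t.
  rewrite [RHS]ffunE; have [tA|tA] := boolP (chain_in (mem A) t); last first.
    apply/eqP; apply: contraNT tA; apply: bd_supported.
    exact: extend_supported.
  by rewrite ffunE -(boundaryE f (Sub t tA)) f0 ffunE.
exists [ffun s => g (simplex_tuple s)]; apply/ffunP => t.
by rewrite boundaryE extend_restrict // gf pairing_indic extend_val.
Qed.

End Simplex.
End Homology.

(** * Homology of intervals *)

Section GrowthHomology.
Context {d : Order.disp_t} {P : finPOrderType d} {T : eqType}.
Variables (rho : P -> nat) (Z : P -> T) (K : comNzRingType).
Hypothesis gP : growth rho Z.
Implicit Types (x y a b : P) (F J : {set P}).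

Definition above x y J : pred P :=
  [pred z | (x < z < y) && [exists a in J, a <= z]].

(** The complex grows by the cone [[a, y)] when the last element [a] of the initial
    segment [J] is added. By [key_exchange] the new part meets the old one in the
    elements of [(a, y)] above a revisited cover of [a]; these covers are initial
    among the atoms of [[a, y]], an interval of length one less. *)
Lemma acyclic_above n x y F J k : (rho y = n + rho x)%N ->
  initial Z x F -> J != set0 ->
  (forall a, a \in J -> covers x a && (a <= y)) ->
  (forall a b, a \in J -> covers x b -> b <= y ->
     (key Z x F b < key Z x F a)%N -> b \in J) ->
  (k.+1 < n)%N -> acyclic K (above x y J) k.
Proof.
elim: n x F J k => // n IHn x F J k ry iF + + + kn.
have [m] := ubnP #|J|; elim: m J => // m IHm J Jm J0 Jcov Jinit.
have [a0 Ja0] := set0Pn _ J0.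
have [a [Ja amax]] : exists a, a \in J /\
    forall b, b \in J -> (key Z x F b <= key Z x F a)%N.
  case: (@arg_maxnP _ a0 (fun a => a \in J) (key Z x F) Ja0) => a Ja amax.
  by exists a.
have /andP[xa ay] := Jcov a Ja.
have ra := covers_rho gP xa.
have lt_ay : a < y.
  rewrite lt_neqAle ay andbT; apply/eqP => e; move: ra; rewrite e ry.
  by move: kn; lia.
have xy : x < y := lt_trans (covers_lt xa) lt_ay.
have Cacyc : acyclic K [pred z | a <= z < y] k.
  apply: (@acyclic_cone _ _ _ a); first by rewrite inE /= lexx.
  by move=> z /andP[].
have [J'0|J'0] := eqVneq (J :\ a) set0.
  apply: acyclic_eq Cacyc => z; rewrite !inE; apply/andP/andP => [[az zy]|[/andP[xz zy]]].
    split; first by rewrite zy andbT (lt_le_trans (covers_lt xa)).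
    by apply/exists_inP; exists a.
  case/exists_inP => b Jb bz; split=> //; suff <- : b = a by [].
  apply/eqP/negPn/negP => nb.
  by have := in_set0 b; rewrite -J'0 !inE nb Jb.
apply: (@acyclic_union _ _ _ _ (above x y (J :\ a)) [pred z | a <= z < y]) => //.
- case=> [//|v w] /andP[sw /= /andP[/andP[/andP[xv vy] /exists_inP[b Jb bv]] wA]].
  have vmin z : z \in w -> v < z.
    by move=> zw; apply: (allP (order_path_min (@lt_trans _ P) sw)).
  have lty z : z \in w -> z < y.
    by move=> /(allP wA)/andP[/andP[]].
  have [eb|nb] := eqVneq b a; apply/orP; [right|left].
    rewrite eb in bv; apply/andP; split=> //=; rewrite !inE bv vy /=.
    apply/allP => z zw; apply/andP; split; last exact: lty.
    exact: le_trans bv (ltW (vmin z zw)).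
  apply/andP; split=> //; apply/allP => z; rewrite inE => zvw.
  have vz : v <= z by case/predU1P: zvw => [->//|/vmin/ltW].
  rewrite !inE; apply/andP; split; last first.
    by apply/exists_inP; exists b; rewrite ?inE ?nb //; apply: le_trans bv vz.
  by rewrite (lt_le_trans xv vz); case/predU1P: zvw => [->|/lty].
- move=> z /andP[xzy /exists_inP[b]]; rewrite inE => /andP[_ Jb] bz.
  by apply/andP; split=> //; apply/exists_inP; exists b.
- move=> z /andP[az zy]; apply/andP; split.
    by rewrite zy andbT (lt_le_trans (covers_lt xa)).
  by apply/exists_inP; exists a.
- apply: IHm => //.
  + by move: Jm; rewrite (cardsD1 a) Ja.
  + by move=> b; rewrite inE => /andP[_ /Jcov].
  move=> b c; rewrite !inE => /andP[nb Jb] xc cy cb.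
  rewrite (Jinit b) // andbT; apply: contraTneq cb => ->.
  by rewrite -leqNgt amax.
move=> k0; pose J' := [set b in revisited Z x F a | b <= y].
have J'E z : (z \in J') = (z \in revisited Z x F a) && (z <= y).
  by rewrite in_set.
have J'P z : (z \in above a y J') = (z \in [predI above x y (J :\ a) & [pred z | a <= z < y]]).
  rewrite !inE; apply/idP/idP.
    case/andP=> /andP[az zy] /exists_inP[b]; rewrite !inE => /andP[/andP[ab]].
    case/existsP => c /andP[/andP[xc ca] cb] byy bz.
    rewrite zy (ltW az) (lt_trans (covers_lt xa) az) !andbT /=.
    apply/exists_inP; exists c; last exact: le_trans (ltW cb) bz.
    rewrite !inE (Jinit a) ?(le_trans (ltW cb)) // andbT.
    by apply: contraTneq ca => ->; rewrite ltnn.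
  case/andP=> /andP[/andP[xz zy] /exists_inP[c]]; rewrite inE => /andP[].
  rewrite inE => nc Jc cz /andP[az _].
  have /andP[xc cy] := Jcov c Jc.
  have ca : (key Z x F c < key Z x F a)%N.
    rewrite ltn_neqAle amax // andbT; apply: contraNneq nc => e.
    exact/eqP/(key_inj e).
  have [e [eF ez]] := key_exchange gP xc xa cz az ca.
  have ae : covers a e by move: eF; rewrite inE => /andP[].
  rewrite zy andbT (lt_le_trans (covers_lt ae) ez) /=.
  by apply/exists_inP; exists e; rewrite // inE eF (le_trans ez (ltW zy)).
apply: acyclic_eq J'P _; apply: (IHn a (revisited Z x F a)).
- by rewrite ra ry addSnnS.
- exact: (initial_revisited gP).
- have [c] := set0Pn _ J'0; rewrite 2!inE => /andP[nc Jc].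
  have /andP[xc cy] := Jcov c Jc.
  have ca : (key Z x F c < key Z x F a)%N.
    rewrite ltn_neqAle amax // andbT; apply: contraNneq nc => e.
    exact/eqP/(key_inj e).
  have [e [eF ey]] := key_exchange gP xc xa cy ay ca.
  by apply/set0Pn; exists e; rewrite inE eF.
- by move=> b; rewrite !inE => /andP[/andP[-> _] ->].
- move=> b c; rewrite !J'E => /andP[bF byy] ac cy cb; rewrite cy andbT.
   apply/negPn/negP => cF.
  have ab : covers a b by move: bF; rewrite inE => /andP[].
  by have := initial_revisited gP xa ab ac bF cF; rewrite ltnNge ltnW.
- by rewrite prednK.
Qed.

(** Bounds the dimension of the order complex of [(x, y)]. *)
Lemma open_chain_size x y s : x < y ->
  chain_in (mem (open_interval x y)) s -> (size s + (rho x).+1 <= rho y)%N.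
Proof.
move=> xy /andP[]; elim: s x xy => [|v s IH] x xy; first by rewrite add0n => _ _; apply: growth_lt gP _ _ xy.
move=> /= sv /andP[]; rewrite inE => /andP[xv vy] sA.
have := IH v vy; have -> : sorted <%O s by case: s sv {IH sA} => //= w s /andP[].
have /allP sv' := order_path_min (@lt_trans _ P) sv.
have -> : all (mem (open_interval v y)) s.
  apply/allP => z zs; have vz : v < z := sv' _ zs.
  by have := allP sA _ zs; rewrite /= !inE vz => /andP[].
by move=> /(_ isT isT); have := growth_lt gP xv; lia.
Qed.

Lemma sorted_lt_comparable (s : seq P) :
  sorted <%O s -> {in s &, forall a b, a >=< b}.
Proof.
elim: s => // v s IH vs a b; have vmin := order_path_min (@lt_trans _ P) vs.
rewrite !inE => /predU1P[->|sa] /predU1P[->|sb].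
- exact: comparablexx.
- by apply: lt_comparable; apply: (allP vmin).
- by rewrite comparable_sym; apply: lt_comparable; apply: (allP vmin).
- by apply: IH; rewrite ?(path_sorted vs).
Qed.

Lemma saturated_mem x y c z : saturated x y c -> z \in x :: c -> x <= z <= y.
Proof.
elim: c x => [|a c IH] x; first by case/andP=> _ /eqP <-; rewrite inE => /eqP->; rewrite lexx.
move=> sc; rewrite inE => /predU1P[->|]; first by rewrite lexx (saturated_le sc).
move: sc; rewrite saturated_cons => /andP[xa ac] /(IH _ ac)/andP[az ->].
by rewrite (le_trans (ltW (covers_lt xa)) az).
Qed.

Lemma interval_lengthE x y : x <= y -> interval_length x y = (rho y - rho x)%N.
Proof.
move=> xy; apply/eqP; rewrite eqn_leq; apply/andP; split.
  apply/bigmax_leqP => C /andP[/forall_inP chC /subsetP Cxy].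
  have inj : {in C &, injective rho}.
    move=> a b aC bC e; have := forall_inP (chC a aC) b bC.
    by case/orP => h; [|symmetry]; apply: (rho_inj_le gP h); rewrite e.
  have sub : {subset [seq rho z | z in C] <= iota (rho x) (rho y - rho x).+1}.
    move=> i /imageP[z /Cxy]; rewrite inE => /andP[xz zy] ->.
    have := rho_le gP xz; have := rho_le gP zy.
    by rewrite mem_iota; lia.
  have := uniq_leq_size _ sub; rewrite size_iota size_image => h.
  by rewrite -subn1 leq_subLR add1n h // map_inj_in_uniq ?enum_uniq // => a b; rewrite !mem_enum; apply: inj.
have i0 : initial Z x set0 by move=> b b' _ _; rewrite inE.
(* Any saturated chain from [x] to [y] attains the maximum. *)
have [c [sc _ _ _ _]] := unique_rising gP 0%R xy i0.
have sz := saturated_size gP sc; move: (sc) => /andP[pc /eqP lc].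
have sorted_c : sorted <%O (x :: c) by apply: sub_path pc => a b /andP[].
pose C := [set z in x :: c].
apply: leq_trans (leq_bigmax_cond C _) => /=; last first.
  apply/andP; split.
    apply/forall_inP => a; rewrite in_set => aC.
    apply/forall_inP => b; rewrite in_set => bC.
    exact: sorted_lt_comparable sorted_c _ _ aC bC.
  by apply/subsetP => z; rewrite !in_set; apply: saturated_mem.
have uC : uniq (x :: c) by apply: (@lt_sorted_uniq _ P).
by rewrite cardsE (card_uniqP uC) /= -sz addnK.
Qed.

Lemma growth_cohen_macaulay_over : cohen_macaulay_over K P.
Proof.
move=> x y xy k kl; apply: acyclic_homology.
rewrite interval_lengthE ?(ltW xy) // in kl.
have [kn|nk] := ltnP k.+1 (rho y - rho x); last first.
  apply: acyclic_void => s sA ks; have := open_chain_size xy sA.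
  by move: kl nk; rewrite ks; have := growth_lt gP xy; lia.
pose J := [set a | covers x a & a <= y].
have [a0 xa0 a0y] := covers_exists gP xy.
have i0 : initial Z x set0 by move=> b b' _ _; rewrite inE.
have Aeq : above x y J =i mem (open_interval x y).
  move=> z; rewrite !inE; apply/andP/idP => [[]//|/andP[xz zy]].
  rewrite xz zy; split=> //; have [a xa az] := covers_exists gP xz.
  by apply/exists_inP; exists a => //; rewrite inE xa (le_trans az (ltW zy)).
apply: acyclic_eq Aeq _; apply: (acyclic_above _ i0 _ _ _ kn).
- by rewrite subnK // ltnW // (growth_lt gP).
- by apply/set0Pn; exists a0; rewrite inE xa0.
- by move=> a; rewrite inE.
by move=> a b _ xb byy _; rewrite inE xb.
Qed.

End GrowthHomology.

(** * Equivariant retractions *)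

Section Retractions.
Variables (T : finType) (neg : T -> T).
Hypotheses (negK : involutive neg) (neg_neq : forall j, neg j != j).
Implicit Types (x y a b c k : {ffun T -> T}) (i j s t p w : T).

(** The maps sending every element to the pointed element of its block, for [T]
    the signed elements. [retr_pm] distinguishes nonzero blocks, with opposite
    points, from the zero block, which is unique by [retr_zero]. *)
Record retraction x : Prop := Retraction {
  retr_idem : forall j, x (x j) = x j;
  retr_neg : forall j, x (neg (x j)) = x (neg j);
  retr_pm : forall j, x (neg j) = neg (x j) \/ x (neg j) = x j;
  retr_zero : forall i j, x (neg i) = x i -> x (neg j) = x j -> x i = x j
}.

Definition retr_le x y := forall j, y (x j) = y j /\ x (y j) = y j.

(** The points of the nonzero blocks. *)
Definition free x s := (x s == s) && (x (neg s) == neg s).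

Definition dead x := [set j | ~~ free x j].

(** Free elements come in opposite pairs, and so do dead ones. *)
Definition rank x := #|dead x|./2.

(** The zero block. *)
Definition zero_fiber x := [set j | x (neg j) == x j].

Lemma neg_inj : injective neg. Proof. exact: can_inj negK. Qed.

Lemma negE i j : (neg i == j) = (i == neg j).
Proof. by rewrite (can2_eq negK negK). Qed.

Lemma freeN x s : free x (neg s) = free x s.
Proof. by rewrite /free negK andbC. Qed.

Lemma free_fix x s : free x s -> x s = s.
Proof. by case/andP=> /eqP. Qed.

Lemma free_neg x s : free x s -> x (neg s) = neg s.
Proof. by case/andP=> _ /eqP. Qed.

Lemma free_nonzero x s : free x s -> x (neg s) <> x s.
Proof.
by move=> fs; rewrite (free_fix fs) (free_neg fs); apply/eqP/neg_neq.
Qed.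

Lemma retr_le_refl x : retraction x -> retr_le x x.
Proof. by move=> rx j; rewrite retr_idem. Qed.

Lemma retr_le_trans x y z : retr_le x y -> retr_le y z -> retr_le x z.
Proof.
move=> xy yz j; have [yz1 yz2] := yz j; have [xy1 xy2] := xy j; split.
  by rewrite -(proj1 (yz _)) xy1 yz1.
by rewrite -yz2 (proj2 (xy _)).
Qed.

Lemma le_neg x y j : retr_le x y -> retraction y -> x (neg j) = x j -> y (neg j) = y j.
Proof. by move=> xy ry e; rewrite -(proj1 (xy _)) e (proj1 (xy _)). Qed.

Lemma le_free x y s : retr_le x y -> free y s -> free x s.
Proof.
move=> xy /andP[/eqP e1 /eqP e2]; apply/andP; split.
  by rewrite -{1}e1 (proj2 (xy _)) e1.
by rewrite -{1}e2 (proj2 (xy _)) e2.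
Qed.

Lemma fix_free x w : retraction x -> x w = w -> x (neg w) <> w -> free x w.
Proof. by move=> rx e n; case: (retr_pm rx w); rewrite /free e => // ->; rewrite !eqxx. Qed.

Lemma zero_fiber_le x y : retr_le x y -> retraction y ->
  zero_fiber x \subset zero_fiber y.
Proof. by move=> xy ry; apply/subsetP => j; rewrite !inE => /eqP e; apply/eqP/(le_neg xy). Qed.

Lemma dead_le x y : retr_le x y -> dead x \subset dead y.
Proof. by move=> xy; apply/subsetP => j; rewrite !inE; apply: contra; apply: le_free. Qed.

Lemma rank_le x y : retr_le x y -> (rank x <= rank y)%N.
Proof. by move=> /dead_le/subset_leq_card; apply: half_leq. Qed.

Lemma rank_succ x y s : free x s -> dead y = dead x :|: [set s; neg s] ->
  rank y = (rank x).+1.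
Proof.
move=> fs e; rewrite /rank e cardsU cards2 eq_sym neg_neq /=.
rewrite (_ : _ :&: _ = set0) ?cards0 ?subn0 ?addn2 //.
apply/setP => j; rewrite !inE andbC; case: eqP => [->|_] /=; first by rewrite fs.
by case: eqP => [->|//]; rewrite freeN fs.
Qed.

(** So a strict inequality makes some free element die, and the rank grows. The
    point is that a zero block pointed at [u] in [x] and at another free [w] in [y]
    kills [w]. *)
Lemma free_eq x y : retraction x -> retraction y -> retr_le x y ->
  (forall s, free x s -> free y s) -> x = y.
Proof.
move=> rx ry xy H; apply/ffunP => j; rewrite -[RHS](proj1 (xy j)).
set u := x j; have xu : x u = u by apply: retr_idem.
have [/H/free_fix->//|nfu] := boolP (free x u).
have xNu : x (neg u) = u.
  by apply/eqP; apply: contraNT nfu => /eqP; apply: fix_free.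
set w := y u; have xw : x w = w := proj2 (xy u).
have yNw : y (neg w) = w.
  by rewrite retr_neg // -(proj1 (xy (neg u))) xNu.
have [fw|nfw] := boolP (free x w).
  case: (free_nonzero (H _ fw)); rewrite yNw; symmetry; exact: retr_idem.
have xNw : x (neg w) = w.
  by apply/eqP; apply: contraNT nfw => /eqP; apply: fix_free.
by rewrite -xu -[RHS]xw; apply: (retr_zero rx); rewrite ?xNu ?xNw.
Qed.

(** For a point [u] of [x]: the block of [u] is that of [s], its opposite, or the
    zero block. *)
Definition absorbed x s u := [|| u == s, u == neg s | x (neg u) == u].

(** Absorb the blocks of [s] and [neg s] into the zero block, with point [p]. If [x]
    has no zero block then [absorbed x s p] forces [p] to be [s] or [neg s], and
    the zero block is created. *)
Definition grow x s p := [ffun j => if absorbed x s (x j) then p else x j].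

Lemma absorbedP x s u : retraction x -> x u = u ->
  absorbed x s u = ~~ [&& free x u, u != s & u != neg s].
Proof.
move=> rx xu; rewrite !negb_and !negbK [RHS]orbC -orbA.
congr (_ || (_ || _)); rewrite /free xu eqxx /=.
case: (retr_pm rx u) => ->; rewrite xu eqxx ?(negbTE (neg_neq _)) //.
by rewrite eq_sym (negbTE (neg_neq _)).
Qed.

Lemma absorbedN x s u : absorbed x (neg s) u = absorbed x s u.
Proof. by rewrite /absorbed negK orbCA. Qed.

Lemma growN x s p : grow x (neg s) p = grow x s p.
Proof. by apply/ffunP => j; rewrite !ffunE absorbedN. Qed.

Section Grow.
Variables (x : {ffun T -> T}) (s p : T).
Hypotheses (rx : retraction x) (fs : free x s) (ap : absorbed x s p).

Lemma absorbed_fix : x p = p.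
Proof.
have xs := free_fix fs; have xNs := free_neg fs.
by case/or3P: ap => /eqP e; rewrite ?e // -{1}e retr_idem.
Qed.

Lemma absorbed_neg j : absorbed x s (x (neg j)) = absorbed x s (x j).
Proof.
rewrite !absorbedP ?retr_idem //; congr (~~ _).
case: (retr_pm rx j) => -> //.
by rewrite freeN negE (negE _ (neg s)) negK [(_ != neg s) && _]andbC.
Qed.

Lemma grow_absorbed j : absorbed x s (x j) -> grow x s p j = p.
Proof. by rewrite ffunE => ->. Qed.

Lemma grow_rest j : absorbed x s (x j) = false -> grow x s p j = x j.
Proof. by rewrite ffunE => ->. Qed.

Lemma grow_retraction : retraction (grow x s p).
Proof.
have xp := absorbed_fix.
have gp : grow x s p p = p by rewrite ffunE xp ap.
have gNp : grow x s p (neg p) = p by rewrite ffunE absorbed_neg xp ap.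
split=> [j|j|j|i j].
- case e: (absorbed x s (x j)); first by rewrite (grow_absorbed e) gp.
  by rewrite (grow_rest e) ffunE retr_idem // e.
- case e: (absorbed x s (x j)).
    by rewrite (grow_absorbed e) gNp grow_absorbed // absorbed_neg.
  by rewrite (grow_rest e) !ffunE retr_neg.
- case e: (absorbed x s (x j)).
    by rewrite !grow_absorbed // ?absorbed_neg //; right.
  by rewrite !grow_rest // ?absorbed_neg //; apply: retr_pm.
have zero u : grow x s p (neg u) = grow x s p u -> grow x s p u = p.
  case e: (absorbed x s (x u)); first by rewrite (grow_absorbed e).
  rewrite !grow_rest // ?absorbed_neg // => xN.
  by move: e; rewrite /absorbed retr_neg // xN eqxx !orbT.
by move=> /zero-> /zero->.
Qed.

Lemma le_grow : retr_le x (grow x s p).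
Proof.
move=> j; split; first by rewrite !ffunE retr_idem.
by rewrite !ffunE; case: ifP => _; rewrite ?absorbed_fix ?retr_idem.
Qed.

Lemma free_grow j : free (grow x s p) j = [&& free x j, j != s & j != neg s].
Proof.
have [fj|nfj] := boolP (free x j); last first.
  by apply/negbTE; apply: contra nfj; apply: le_free le_grow.
have xj := free_fix fj; have := absorbedP s rx xj; rewrite fj /= => aj.
case e: (absorbed x s j); last first.
  rewrite e in aj; rewrite -[RHS]negbK -aj /free !grow_rest ?absorbed_neg ?xj //.
  by rewrite (free_neg fj) !eqxx.
rewrite e in aj; rewrite -[RHS]negbK -aj; apply/negbTE/negP => /free_nonzero; apply.
by rewrite !grow_absorbed ?absorbed_neg ?xj.
Qed.

Lemma rank_grow : rank (grow x s p) = (rank x).+1.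
Proof.
apply: (rank_succ fs); apply/setP => j; rewrite !inE free_grow !negb_and !negbK.
by [].
Qed.

Lemma zero_fiber_grow : zero_fiber (grow x s p) = [set j | absorbed x s (x j)].
Proof.
apply/setP => j; rewrite !inE.
case e: (absorbed x s (x j)); first by rewrite !grow_absorbed ?absorbed_neg ?eqxx.
rewrite !grow_rest ?absorbed_neg //; apply/negbTE; apply: contraFN e => /eqP e.
by rewrite /absorbed retr_neg // e eqxx !orbT.
Qed.

Lemma grow_zero_fiber : zero_fiber (grow x s p) <> zero_fiber x.
Proof.
move/setP/(_ s); rewrite zero_fiber_grow !inE (free_fix fs) /absorbed eqxx /=.
by rewrite (free_neg fs) (negbTE (neg_neq s)).
Qed.

(** [y] cannot have as a point any of the points that [grow x s p] has removed;
    this is all that is required, besides [s] being in the zero block of [y]. *)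
Lemma grow_le y : retraction y -> retr_le x y -> y (neg s) = y s ->
  (absorbed x s (y s) -> y s = p) -> retr_le (grow x s p) y.
Proof.
move=> ry xy yNs yp.
have ya j : absorbed x s (x j) -> y j = y s.
  rewrite -(proj1 (xy j)); case/or3P => /eqP e; rewrite ?e //.
  apply: (retr_zero ry) => //.
  by rewrite -(proj1 (xy (neg _))) e.
have xys : x (y s) = y s := proj2 (xy s).
move=> j; split.
  case e: (absorbed x s (x j)).
    by rewrite grow_absorbed // (ya j e) (ya p) ?absorbed_fix.
  by rewrite grow_rest // (proj1 (xy j)).
have xyj := proj2 (xy j).
case e: (absorbed x s (y j)); last by rewrite grow_rest xyj.
have yj : y j = y s by rewrite -[LHS](retr_idem ry) ya // xyj.
by rewrite grow_absorbed ?xyj // yj yp // -yj.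
Qed.

End Grow.

Lemma grow_exists x y s : retraction x -> retraction y -> retr_le x y ->
  free x s -> y (neg s) = y s ->
  exists2 p, absorbed x s p & retr_le (grow x s p) y.
Proof.
move=> rx ry xy fs yNs; case e: (absorbed x s (y s)).
  by exists (y s) => //; apply: grow_le.
have a : absorbed x s s by rewrite /absorbed eqxx.
by exists s => //; apply: grow_le => //; rewrite e.
Qed.

(** Join the block of [s] to that of [t], keeping the point [t], and the opposite
    blocks accordingly. *)
Definition merge x s t :=
  [ffun j => if x j == s then t else if x j == neg s then neg t else x j].

Lemma mergeN x s t : merge x (neg s) (neg t) = merge x s t.
Proof.
apply/ffunP => j; rewrite !ffunE !negK; case: eqP => [->|//].
by rewrite (negbTE (neg_neq _)).
Qed.

Section Merge.
Variables (x : {ffun T -> T}) (s t : T).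
Hypotheses (rx : retraction x) (fs : free x s) (ft : free x t).
Hypotheses (nts : t != s) (ntNs : t != neg s).

Lemma merge_s j : x j = s -> merge x s t j = t.
Proof. by rewrite ffunE => ->; rewrite eqxx. Qed.

Lemma merge_Ns j : x j = neg s -> merge x s t j = neg t.
Proof. by rewrite ffunE => ->; rewrite (negbTE (neg_neq _)) eqxx. Qed.

Lemma merge_rest j : x j != s -> x j != neg s -> merge x s t j = x j.
Proof. by rewrite ffunE => /negbTE-> /negbTE->. Qed.

(** Records the value at [neg j] as well, so that one case analysis treats opposite
    elements together. *)
Variant merge_spec j : T -> Prop :=
  | MergeS of x j = s & x (neg j) = neg s : merge_spec j t
  | MergeNs of x j = neg s & x (neg j) = s : merge_spec j (neg t)
  | MergeRest of x j != s & x j != neg s & x (neg j) != s & x (neg j) != neg s :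
      merge_spec j (x j).

Lemma mergeP j : merge_spec j (merge x s t j).
Proof.
have xs := free_fix fs; have xNs := free_neg fs.
have [e|n1] := eqVneq (x j) s.
  by rewrite merge_s //; apply: MergeS => //; rewrite -retr_neg // e.
have [e|n2] := eqVneq (x j) (neg s).
  by rewrite merge_Ns //; apply: MergeNs => //; rewrite -retr_neg // e negK.
rewrite merge_rest //; apply: MergeRest => //.
  by case: (retr_pm rx j) => ->//; rewrite negE.
by case: (retr_pm rx j) => ->//; rewrite (inj_eq neg_inj).
Qed.

Lemma merge_free j : free x j -> j != s -> j != neg s ->
  merge x s t j = j /\ merge x s t (neg j) = neg j.
Proof.
move=> fj n1 n2; rewrite !merge_rest ?(free_neg fj) ?(free_fix fj) //.
  by rewrite negE.
by rewrite (inj_eq neg_inj).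
Qed.

Lemma merge_retraction : retraction (merge x s t).
Proof.
have [mt mNt] := merge_free ft nts ntNs.
split=> [j|j|j|i j].
- case: (mergeP j) => // n1 n2 _ _; rewrite merge_rest ?retr_idem //.
- case: (mergeP j) => [e1 e2|e1 e2|n1 n2 n3 n4].
  + by rewrite mNt merge_Ns.
  + by rewrite negK mt merge_s.
  + by rewrite [RHS]merge_rest // merge_rest ?retr_neg.
- case: (mergeP j) => [e1 e2|e1 e2|n1 n2 n3 n4].
  + by left; rewrite merge_Ns.
  + by left; rewrite negK merge_s.
  + by rewrite merge_rest //; apply: retr_pm.
have zero u : merge x s t (neg u) = merge x s t u ->
    x (neg u) = x u /\ merge x s t u = x u.
  case: (mergeP u) => [e1 e2|e1 e2|n1 n2 n3 n4].
  + by rewrite merge_Ns // => /eqP; rewrite (negbTE (neg_neq _)).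
  + by rewrite merge_s // => /esym/eqP; rewrite (negbTE (neg_neq _)).
  + by rewrite merge_rest.
by move=> /zero[zi ->] /zero[zj ->]; apply: retr_zero.
Qed.

Lemma le_merge : retr_le x (merge x s t).
Proof.
move=> j; split; first by rewrite !ffunE retr_idem.
by case: (mergeP j) => *; rewrite ?(free_fix ft) ?(free_neg ft) ?retr_idem.
Qed.

Lemma free_merge j : free (merge x s t) j = [&& free x j, j != s & j != neg s].
Proof.
have [fj|nfj] := boolP (free x j); last first.
  by apply/negbTE; apply: contra nfj; apply: le_free le_merge.
have [->|n1] := eqVneq j s.
  by apply/negbTE; rewrite /free negb_and merge_s ?nts // (free_fix fs).
have [->|n2] := eqVneq j (neg s).
  by apply/negbTE; rewrite freeN /free negb_and merge_s ?nts // (free_fix fs).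
by have [e1 e2] := merge_free fj n1 n2; rewrite /free e1 e2 !eqxx.
Qed.

Lemma rank_merge : rank (merge x s t) = (rank x).+1.
Proof.
apply: (rank_succ fs); apply/setP => j; rewrite !inE free_merge !negb_and !negbK.
by [].
Qed.

Lemma zero_fiber_merge : zero_fiber (merge x s t) = zero_fiber x.
Proof.
apply/setP => j; rewrite !inE; case: (mergeP j) => [e1 e2|e1 e2|n1 n2 n3 n4].
- by rewrite merge_Ns // e1 e2 !(negbTE (neg_neq _)).
- by rewrite merge_s // e1 e2 ![_ == neg _]eq_sym !(negbTE (neg_neq _)).
- by rewrite merge_rest.
Qed.

(** As [s] and [neg s] are removed from the points, they must not be points of [y];
    the conditions on [y s] express this. *)
Lemma merge_le y : retraction y -> retr_le x y -> y s = y t ->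
  y s != s -> y s != neg s -> retr_le (merge x s t) y.
Proof.
move=> ry xy yst n1 n2; have yNst : y (neg s) = y (neg t).
  by rewrite -retr_neg // yst retr_neg.
move=> j; split.
  rewrite -[RHS](proj1 (xy j)).
  by case: (mergeP j) => [->|->|] // _ _ _ _; rewrite (proj1 (xy j)).
have xyj := proj2 (xy j); rewrite merge_rest ?xyj //.
  by apply: contraNneq n1 => e; rewrite -e retr_idem.
apply: contraNneq n2 => e; have yNs : y (neg s) = neg s by rewrite -e retr_idem.
case: (retr_pm ry s) => e'; last by rewrite -e' yNs.
by case/eqP: n1; apply: neg_inj; rewrite -e'.
Qed.

End Merge.

(** Choose a free point [s] of [x] that dies in [y]: it is absorbed if [y] puts it
    into the zero block, and merged with the point [y s] otherwise. *)
Lemma elementary_exists x y : retraction x -> retraction y -> retr_le x y ->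
  x <> y ->
  (exists s p, [/\ free x s, absorbed x s p & retr_le (grow x s p) y]) \/
  (exists s t, [/\ free x s, free x t, t != s, t != neg s &
                   retr_le (merge x s t) y]).
Proof.
move=> rx ry xy nxy.
have /existsP[s /andP[fs nfs]] : [exists s, free x s && ~~ free y s].
  apply/existsPn => H; apply: nxy; apply: free_eq => // s fs.
  by have := H s; rewrite fs negbK.
have [yNs|/eqP yNs] := eqVneq (y (neg s)) (y s).
  have [p ap le] := grow_exists rx ry xy fs yNs.
  by left; exists s, p.
right; exists s, (y s); set w := y s in yNs *.
have yw : y w = w by apply: retr_idem.
have nws : w != s.
  apply: contra nfs => /eqP e; apply: fix_free => //.
  by rewrite -{2}e.
have nwNs : w != neg s.
  apply/eqP => e; apply: yNs; rewrite -e yw //.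
have fw : free y w.
  by apply: fix_free => // e; apply: yNs; rewrite -(retr_neg ry s).
split=> //; first exact: le_free fw.
by apply: merge_le => //; rewrite ?yw // (le_free xy fw).
Qed.

Lemma rank_lt x y : retraction x -> retraction y -> retr_le x y -> x <> y ->
  (rank x < rank y)%N.
Proof.
move=> rx ry xy /(elementary_exists rx ry xy)[[s [p [fs ap le]]]|[s [t [fs ft n1 n2 le]]]].
  by rewrite -(rank_grow rx fs ap) rank_le.
by rewrite -(rank_merge rx fs ft n1) rank_le.
Qed.

Lemma rank_eq x y : retraction x -> retraction y -> retr_le x y ->
  rank x = rank y -> x = y.
Proof.
move=> rx ry xy e; apply/eqP/negPn/negP => /eqP nxy.
by have := rank_lt rx ry xy nxy; rewrite e ltnn.
Qed.

Lemma retr_step x y : retraction x -> retraction y -> retr_le x y -> x <> y ->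
  exists k, [/\ retraction k, retr_le x k, retr_le k y & rank k = (rank x).+1].
Proof.
move=> rx ry xy /(elementary_exists rx ry xy)[[s [p [fs ap le]]]|[s [t [fs ft n1 n2 le]]]].
  exists (grow x s p); split=> //; first exact: grow_retraction.
    exact: le_grow.
  exact: rank_grow.
exists (merge x s t); split=> //; first exact: merge_retraction.
  exact: le_merge.
exact: rank_merge.
Qed.

Lemma cover_elementary x a : retraction x -> retraction a -> retr_le x a ->
  rank a = (rank x).+1 ->
  (exists s p, [/\ free x s, absorbed x s p & a = grow x s p]) \/
  (exists s t, [/\ free x s, free x t, t != s, t != neg s & a = merge x s t]).
Proof.
move=> rx ra xa ea.
have nxa : x <> a by move=> e; rewrite e in ea; apply: (n_Sn (rank a)).
case: (elementary_exists rx ra xa nxa) => [[s [p [fs ap le]]]|[s [t [fs ft n1 n2 le]]]].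
  left; exists s, p; split=> //; symmetry; apply: rank_eq => //.
    exact: grow_retraction.
  by rewrite rank_grow.
right; exists s, t; split=> //; symmetry; apply: rank_eq => //.
  exact: merge_retraction.
by rewrite rank_merge.
Qed.

Lemma zero_fiber_mono x y b : retraction y -> retraction b ->
  retr_le x y -> retr_le y b -> zero_fiber b = zero_fiber x ->
  zero_fiber y = zero_fiber x.
Proof.
move=> ry rb xy yb e; apply/eqP; rewrite eqEsubset (zero_fiber_le xy ry) andbT.
by rewrite -e zero_fiber_le.
Qed.

Lemma grow_step x y : retraction x -> retraction y -> retr_le x y ->
  zero_fiber y <> zero_fiber x ->
  exists k, [/\ retraction k, retr_le x k, retr_le k y, rank k = (rank x).+1
              & zero_fiber k <> zero_fiber x].
Proof.
move=> rx ry xy /eqP; rewrite eqEsubset (zero_fiber_le xy ry) andbT.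
case/subsetPn => j; rewrite !inE => /eqP yNj /eqP xNj.
have fs : free x (x j).
  apply: fix_free; rewrite ?retr_idem // retr_neg // => e; exact: xNj.
have yNs : y (neg (x j)) = y (x j).
  by rewrite -(proj1 (xy (neg (x j)))) retr_neg // !(proj1 (xy _)).
have [p ap le] := grow_exists rx ry xy fs yNs.
exists (grow x (x j) p); split=> //; first exact: grow_retraction.
- exact: le_grow.
- exact: rank_grow.
- exact: grow_zero_fiber.
Qed.

Lemma cover_grow x a : retraction x -> retraction a -> retr_le x a ->
  rank a = (rank x).+1 -> zero_fiber a <> zero_fiber x ->
  exists s p, [/\ free x s, absorbed x s p & a = grow x s p].
Proof.
move=> rx ra xa ea za; case: (cover_elementary rx ra xa ea) => // -[s [t [fs ft n1 n2 e]]].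
by case: za; rewrite e zero_fiber_merge.
Qed.

Lemma cover_merge x a : retraction x -> retraction a -> retr_le x a ->
  rank a = (rank x).+1 -> zero_fiber a = zero_fiber x ->
  exists s t, [/\ free x s, free x t, t != s, t != neg s & a = merge x s t].
Proof.
move=> rx ra xa ea za; case: (cover_elementary rx ra xa ea) => // -[s [p [fs ap e]]].
by case: (grow_zero_fiber (p := p) rx fs); rewrite -e.
Qed.

Lemma absorbed_free x s s' : retraction x -> free x s' -> absorbed x s s' ->
  s' = s \/ s' = neg s.
Proof.
move=> rx fs'; rewrite absorbedP ?(free_fix fs') // fs' /= negb_and !negbK.
by case/orP => /eqP; [left|right].
Qed.

(** A point of [y] in the zero block of [grow x s p] can only be [p]. *)
Lemma absorbed_point x s p y w : retraction x -> free x s -> absorbed x s p ->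
  retr_le (grow x s p) y -> absorbed x s w -> y w = w -> w = p.
Proof.
move=> rx fs ap le aw yw; have := proj2 (le w); rewrite yw => <-.
by rewrite grow_absorbed // (absorbed_fix rx fs aw).
Qed.

(** If the zero blocks of [a] and [c] agree, then [a] and [b] absorb the same pair,
    and the point of the zero block of [c] must be the one chosen by both. *)
Lemma grow_indep x a b c : retraction x -> retraction a -> retraction b ->
  retraction c -> retr_le x a -> retr_le x b ->
  rank a = (rank x).+1 -> rank b = (rank x).+1 ->
  zero_fiber a <> zero_fiber x -> zero_fiber b <> zero_fiber x -> a <> b ->
  retr_le a c -> retr_le b c -> zero_fiber c <> zero_fiber a.
Proof.
move=> rx ra rb rc xa xb ea eb za zb nab ac bc ez; apply: nab.
case: (cover_grow rx ra xa ea za) => s [p [fs ap ea']].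
case: (cover_grow rx rb xb eb zb) => s' [p' [fs' ap' eb']].
have s'z : s' \in zero_fiber b.
  by rewrite eb' zero_fiber_grow // inE (free_fix fs') /absorbed eqxx.
have : s' \in zero_fiber a by rewrite -ez (subsetP (zero_fiber_le bc rc)).
rewrite ea' zero_fiber_grow // inE (free_fix fs') => as'.
have e : grow x s' p' = grow x s p'.
  by case: (absorbed_free rx fs' as') => ->; rewrite ?growN.
rewrite eb' e; set w := c s.
have cw : c w = w by apply: retr_idem.
have : w \in zero_fiber c.
  have : s \in zero_fiber c.
    rewrite ez ea' zero_fiber_grow // inE (free_fix fs) /absorbed eqxx //.
  by rewrite !inE retr_neg // cw => /eqP->.
have xw : x w = w by rewrite -{1}cw (proj2 (retr_le_trans xa ac w)) cw.
rewrite ez ea' zero_fiber_grow // inE xw => aw.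
have ap'' : absorbed x s p' by case: (absorbed_free rx fs' as') ap' => ->; rewrite ?absorbedN.
congr (grow x s _); transitivity w; first symmetry.
  by apply: (absorbed_point rx fs ap _ aw cw); rewrite -ea'.
by apply: (absorbed_point rx fs ap'' _ aw cw); rewrite -e -eb'.
Qed.

Section GrowExchange.
Variables (x y : {ffun T -> T}).
Hypotheses (rx : retraction x) (ry : retraction y).

(** The upper bound lets [grow x s p] absorb [s'] too; its zero block may be pointed
    at [p'] only if this is a point of [grow x s p]; and if the point of the zero
    block of [y] is available, then it has to be [p']. *)
Lemma grow_common s p s' p' (a := grow x s p) : free x s -> absorbed x s p ->
  free x s' -> absorbed x s' p' -> s' != s -> s' != neg s ->
  retr_le a y -> retr_le (grow x s' p') y -> absorbed a s' p' ->
  (absorbed a s' (y s') -> y s' = p') ->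
  exists c, [/\ retraction c, retr_le a c, retr_le (grow x s' p') c,
    retr_le c y & rank c = (rank x).+2].
Proof.
move=> fs ap fs' ap' n1 n2 ay byy aap' aw.
have ra : retraction a by apply: grow_retraction.
have fa : free a s' by rewrite free_grow // fs' n1.
have rb : retraction (grow x s' p') by apply: grow_retraction.
have rc : retraction (grow a s' p') by apply: grow_retraction.
have xb : retr_le x (grow x s' p') by apply: le_grow.
have ac : retr_le a (grow a s' p') by apply: le_grow.
have cs' : grow a s' p' s' = p'.
  by rewrite grow_absorbed // (free_fix fa) /absorbed eqxx.
have cNs' : grow a s' p' (neg s') = p'.
  by rewrite grow_absorbed // (free_neg fa) /absorbed eqxx orbT.
exists (grow a s' p'); split=> //.
- apply: grow_le; rewrite ?cs' ?cNs' //.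
  by apply: retr_le_trans ac; apply: le_grow.
- apply: grow_le => //; rewrite -(proj1 (byy (neg s'))) -(proj1 (byy s')).
  by rewrite !grow_absorbed ?(free_fix fs') ?(free_neg fs') /absorbed ?eqxx ?orbT.
by rewrite rank_grow // rank_grow.
Qed.

Lemma grow_zero_point s p u : free x s -> absorbed x s p ->
  grow x s p u = u -> grow x s p (neg u) = u -> u = p.
Proof.
move=> fs ap au aNu; have xa := le_grow rx fs ap.
have xu : x u = u by rewrite -{1}au (proj2 (xa u)) au.
rewrite -{1}au; apply: grow_absorbed; rewrite xu; apply: contraT.
rewrite absorbedP // negbK => /and3P[fu m1 m2].
have : free (grow x s p) u by rewrite free_grow // fu m1.
by move/free_nonzero; rewrite au aNu.
Qed.

(** Let [w] be the point of the zero block of [y]. If both covers absorb the same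
    pair with different points then [w] is in a third block, which both can absorb
    next. Otherwise one of [p], [p'] can point the zero block absorbing both pairs,
    and the case analysis picks it. *)
Lemma grow_exchange s p s' p' : free x s -> absorbed x s p ->
  free x s' -> absorbed x s' p' -> grow x s p <> grow x s' p' ->
  retr_le (grow x s p) y -> retr_le (grow x s' p') y ->
  exists c, [/\ retraction c, retr_le (grow x s p) c, retr_le (grow x s' p') c,
    retr_le c y & rank c = (rank x).+2].
Proof.
move=> fs ap fs' ap' nab ay byy.
have ra := grow_retraction rx fs ap; have rb := grow_retraction rx fs' ap'.
have xa := le_grow rx fs ap; have xb := le_grow rx fs' ap'.
have xy := retr_le_trans xa ay.
have yz u q : free x u -> absorbed x u q -> retr_le (grow x u q) y -> y (neg u) = y u.
  move=> fu aq le; rewrite -(proj1 (le (neg u))) -(proj1 (le u)).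
  by rewrite !grow_absorbed ?(free_fix fu) ?(free_neg fu) /absorbed ?eqxx ?orbT.
set w := y s; have yNs : y (neg s) = w := yz s p fs ap ay.
have yw : y w = w by apply: retr_idem.
have yNs' : y (neg s') = y s' := yz s' p' fs' ap' byy.
have ys' : y s' = w by apply: (retr_zero ry).
have yNw : y (neg w) = w by rewrite retr_neg.
have xw : x w = w := proj2 (xy s).
have wp : absorbed x s w -> w = p.
  by move=> aw; apply: absorbed_point rx fs ap ay aw yw.
have wp' : absorbed x s' w -> w = p'.
  by move=> aw; apply: absorbed_point rx fs' ap' byy aw yw.
have ss : absorbed x s s by rewrite /absorbed eqxx.
have ss' : absorbed x s' s' by rewrite /absorbed eqxx.
(* Is the same pair absorbed by both? *)
have [ass'|nss'] := boolP (absorbed x s s').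
  have e q : grow x s' q = grow x s q.
    by case: (absorbed_free rx fs' ass') => ->; rewrite ?growN.
  have aE u : absorbed x s' u = absorbed x s u.
    by case: (absorbed_free rx fs' ass') => ->; rewrite ?absorbedN.
  have naw : ~~ absorbed x s w.
    by apply/negP => aw; apply: nab; rewrite e -wp // -wp' ?aE.
  have := naw; rewrite absorbedP // negbK => /and3P[fw n1 n2].
  have faw : free (grow x s p) w by rewrite free_grow // fw n1.
  have aww : absorbed (grow x s p) w w by rewrite /absorbed eqxx.
  have ap2 : absorbed (grow x s p) w p.
    rewrite /absorbed !grow_absorbed ?absorbed_neg ?(absorbed_fix rx fs ap) //.
    by rewrite eqxx !orbT.
  have cs q : absorbed x s q -> x q = q -> grow (grow x s p) w w q = w.
    move=> aq xq; rewrite grow_absorbed // (grow_absorbed (x := x)) ?xq //.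
  exists (grow (grow x s p) w w); split.
  - exact: grow_retraction.
  - exact: le_grow.
  - have cs'w : grow (grow x s p) w w s' = w by apply: cs (free_fix fs').
    apply: grow_le => //.
    + exact: grow_retraction.
    + by apply: retr_le_trans xa (le_grow _ _ _).
    + rewrite cs'w cs ?(free_neg fs') // -(free_neg fs').
      by rewrite absorbed_neg // (free_fix fs').
    + by rewrite cs'w => /wp'.
  - by apply: grow_le => //; rewrite yw.
  - by rewrite rank_grow // rank_grow.
have [n1 n2] : s' != s /\ s' != neg s.
  by split; apply: contraNneq nss' => ->; rewrite /absorbed ?eqxx ?orbT.
have n3 : s != s' by rewrite eq_sym.
have n4 : s != neg s' by rewrite -negE eq_sym.
have flip c : [/\ retraction c, retr_le (grow x s' p') c, retr_le (grow x s p) c,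
    retr_le c y & rank c = (rank x).+2] ->
    [/\ retraction c, retr_le (grow x s p) c, retr_le (grow x s' p') c,
    retr_le c y & rank c = (rank x).+2] by case.
have bw : grow x s' p' w = w := proj2 (byy s).
have aw : grow x s p w = w := proj2 (ay s).
(* If [w] is [p], then the common cover has to be pointed at [p]. *)
have [ewp|nwp] := eqVneq w p.
  have [|//|c /flip] := grow_common fs' ap' fs ap n3 n4 byy ay; last by exists c.
  case/or3P: (ap) => [e|e|/eqP e]; rewrite /absorbed ?e ?orbT //.
  have ap2 : absorbed x s' p by rewrite /absorbed e eqxx !orbT.
  have epp : p = p' by rewrite -[LHS]ewp; apply: wp'; rewrite ewp.
  by rewrite (grow_absorbed (s := s')) ?e // -epp eqxx !orbT.
have [C1|nC1] := boolP (absorbed (grow x s p) s' p').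
  have [|c Hc] := grow_common fs ap fs' ap' n1 n2 ay byy C1; last by exists c.
  rewrite ys' => /or3P[/eqP e|/eqP e|/eqP e].
  - by apply: wp'; rewrite e.
  - by apply: wp'; rewrite e /absorbed eqxx orbT.
  - by rewrite (grow_zero_point fs ap aw e) eqxx in nwp.
(* What remains: [p'] is the point of the zero block of [x], which the first
   cover discards, so [p] has to be kept. *)
have xNp' : x (neg p') = p'.
  by apply/eqP; case/or3P: (ap') => // e; rewrite /absorbed e ?orbT in nC1.
have xp' : x p' = p' := absorbed_fix rx fs' ap'.
have ap2 : absorbed x s p' by rewrite /absorbed xNp' eqxx !orbT.
have npp : p != p'.
  by apply: contraNneq nC1 => e; rewrite /absorbed (grow_absorbed (s := s)) ?xNp' // e eqxx !orbT.
have ps : (p == s) || (p == neg s).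
  case/or3P: (ap) => [->|->|/eqP e]; rewrite ?orbT //; case/eqP: npp.
  rewrite -(absorbed_fix rx fs ap) -xp'; apply: (retr_zero rx).
    by rewrite e (absorbed_fix rx fs ap).
  by rewrite xp'.
have [||c /flip] := grow_common fs' ap' fs ap n3 n4 byy ay; last by exists c.
  by rewrite /absorbed; case/orP: ps => ->; rewrite ?orbT.
case/or3P => /eqP e.
- by apply: wp; rewrite -/w in e; rewrite e.
- by apply: wp; rewrite -/w in e; rewrite e /absorbed eqxx orbT.
- by apply: wp; rewrite (grow_zero_point fs' ap' bw e).
Qed.
End GrowExchange.

Section MergeExchange.
Variables (x y : {ffun T -> T}).
Hypotheses (rx : retraction x) (ry : retraction y).
Hypothesis zxy : zero_fiber y = zero_fiber x.

Lemma free_stays j : free x j -> y (neg j) <> y j.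
Proof.
move=> fj /eqP e; have : j \in zero_fiber y by rewrite inE.
by rewrite zxy inE => /eqP; apply: free_nonzero.
Qed.

Definition common a b := exists c,
  [/\ retraction c, retr_le a c, retr_le b c, retr_le c y & rank c = (rank x).+2].

Lemma commonC a b : common a b -> common b a.
Proof. by case=> c [rc ac bc cy ec]; exists c. Qed.

Record mergeable s t : Prop := Mergeable {
  mer_s : free x s; mer_t : free x t; mer_ts : t != s; mer_tNs : t != neg s;
  mer_le : retr_le (merge x s t) y }.

Lemma mergeableN s t : mergeable s t -> mergeable (neg s) (neg t).
Proof.
case=> fs ft n1 n2 le; split; rewrite ?freeN ?mergeN //.
  by rewrite (inj_eq neg_inj).
by rewrite negE negK.
Qed.

Lemma mergeable_spec s t : mergeable s t ->
  [/\ y s = y t, y s != s & y s != neg s].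
Proof.
case=> fs ft n1 n2 le.
have yst : y s = y t by rewrite -(proj1 (le s)) (merge_s _ (free_fix fs)).
have fms : free (merge x s t) (y s) -> y s != s /\ y s != neg s.
  by rewrite free_merge // => /and3P[].
have xy := retr_le_trans (le_merge rx fs ft) le.
suff /fms[] : free (merge x s t) (y s) by [].
apply: le_free le _; apply: fix_free => //; first exact: retr_idem.
by rewrite retr_neg //; apply: free_stays.
Qed.

(** As long as [t] survives the second merge, the first one can still be performed
    after it. *)
Lemma merge_common_commute s t s' t' : mergeable s t -> mergeable s' t' ->
  s' != s -> s' != neg s -> t != s' -> t != neg s' ->
  common (merge x s t) (merge x s' t').
Proof.
move=> m m' n1 n2 n3 n4; have [yst ns nNs] := mergeable_spec m.
case: m m' => fs ft nts ntNs le [fs' ft' nts' ntNs' le'].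
have rb := merge_retraction rx fs' ft' nts' ntNs'.
have fbs : free (merge x s' t') s.
  by rewrite free_merge // fs eq_sym n1 -negE eq_sym n2.
have fbt : free (merge x s' t') t by rewrite free_merge // ft n3.
have rc := merge_retraction rb fbs fbt nts ntNs.
have bc := le_merge rb fbs fbt.
have xc := retr_le_trans (le_merge rx fs' ft') bc.
exists (merge (merge x s' t') s t); split=> //.
- apply: merge_le => //; rewrite (merge_s (s := s)) ?(free_fix fbs) //.
  by case: (merge_free t fbt nts ntNs).
- exact: merge_le.
- by rewrite rank_merge // rank_merge.
Qed.

(** The same pair is joined to two others; join these. Keeping [t'] is possible when
    [y] does not keep [t]; at least one of the two orders of [t] and [t'] works. *)
Lemma merge_common_source s t t' : mergeable s t -> mergeable s t' -> t != t' ->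
  y s != t -> common (merge x s t) (merge x s t').
Proof.
move=> m m' ntt' nyst; have [yst ns nNs] := mergeable_spec m.
have [yst' _ _] := mergeable_spec m'.
case: m m' => fs ft nts ntNs le [_ ft' nts' ntNs' le'].
have nt'Nt : t' != neg t.
  by apply: contra_notN (free_stays ft) => /eqP <-; rewrite -yst' yst.
have ra := merge_retraction rx fs ft nts ntNs.
have fat : free (merge x s t) t by rewrite free_merge // ft nts.
have fat' : free (merge x s t) t' by rewrite free_merge // ft' nts'.
have nt't : t' != t by rewrite eq_sym.
have rc := merge_retraction ra fat fat' nt't nt'Nt.
have ac := le_merge ra fat fat'.
have xc := retr_le_trans (le_merge rx fs ft) ac.
have cs : merge (merge x s t) t t' s = t'.
  by rewrite merge_s // merge_s // free_fix.
have [ct' _] := merge_free t' fat' nt't nt'Nt.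
exists (merge (merge x s t) t t'); split=> //.
- by apply: merge_le => //; rewrite cs ?ct'.
- apply: merge_le => //; rewrite -?yst //.
  by apply/eqP => e; apply: (free_stays ft); rewrite -e retr_idem.
- by rewrite rank_merge // rank_merge.
Qed.

(** The same blocks are joined with different points, so the point [w] of [y] is in
    a third block, to be joined next. *)
Lemma merge_common_blocks s t : mergeable s t -> mergeable t s ->
  common (merge x s t) (merge x t s).
Proof.
move=> m m'; have [yst ns nNs] := mergeable_spec m.
have [_ nt nNt] := mergeable_spec m'.
case: m m' => fs ft nts ntNs le [_ _ nst nsNt le'].
have ra := merge_retraction rx fs ft nts ntNs.
set w := y t; have xy := retr_le_trans (le_merge rx fs ft) le.
have fw : free x w.
  apply: le_free xy _; apply: fix_free => //; first exact: retr_idem.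
  by rewrite /w retr_neg //; apply: free_stays.
have fat : free (merge x s t) t by rewrite free_merge // ft nts.
have faw : free (merge x s t) w by rewrite free_merge // fw /w -yst ns.
have rc := merge_retraction ra fat faw nt nNt.
have ac := le_merge ra fat faw.
have xc := retr_le_trans (le_merge rx fs ft) ac.
have cs : merge (merge x s t) t w s = w.
  by rewrite merge_s // merge_s // free_fix.
have ct : merge (merge x s t) t w t = w by rewrite merge_s // free_fix.
exists (merge (merge x s t) t w); split=> //.
- by apply: merge_le => //; rewrite ct.
- by apply: merge_le => //; rewrite retr_idem.
- by rewrite rank_merge // rank_merge.
Qed.

(** Without the hypothesis on zero blocks the merges from [s] to [t] and from [t]
    to [neg s] would be an obstruction; here they would put [s] into the zero block
    of [y]. *)
Lemma merge_exchange s t s' t' : mergeable s t -> mergeable s' t' ->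
  merge x s t <> merge x s' t' -> common (merge x s t) (merge x s' t').
Proof.
move=> m m' nab.
(* Up to replacing [s', t'] by their opposites, the pairs meet in one of the two
   ways [s' = s] and [s' = t], treated by [same] and [chain]. *)
have same t0 : mergeable s t0 -> merge x s t <> merge x s t0 ->
    common (merge x s t) (merge x s t0).
  move=> m0 nab0; have nt : t != t0 by apply: contra_not_neq nab0 => ->.
  have [yt|] := eqVneq (y s) t; last exact: merge_common_source.
  apply: commonC; apply: merge_common_source => //; first by rewrite eq_sym.
  by rewrite yt.
have [e|n1] := eqVneq s' s; first by rewrite e in m' nab *; apply: same.
have [e|n2] := eqVneq s' (neg s).
  move: (mergeableN m') nab; rewrite -[merge x s' t']mergeN e negK.
  exact: same.
have chain t0 : mergeable t t0 -> common (merge x s t) (merge x t t0).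
  move=> m0; have [e|n3] := eqVneq t0 s; first by rewrite e in m0 *; apply: merge_common_blocks.
  have [e|n4] := eqVneq t0 (neg s).
    have [yst _ _] := mergeable_spec m; have [ytt _ _] := mergeable_spec m0.
    by case: (free_stays (mer_s m)); rewrite -e -ytt.
  apply: commonC; apply: merge_common_commute => //.
  - by rewrite eq_sym (mer_ts m).
  - by rewrite -negE eq_sym (mer_tNs m).
have [e|n3] := eqVneq t s'; first by rewrite -e in m' *; apply: chain.
have [e|n4] := eqVneq t (neg s').
  rewrite -[merge x s' t']mergeN -e; apply: chain.
  by rewrite e; apply: mergeableN.
exact: merge_common_commute.
Qed.

End MergeExchange.

Lemma retr_exchange x y a b : retraction x -> retraction y -> retraction a ->
  retraction b -> retr_le x a -> retr_le x b ->
  rank a = (rank x).+1 -> rank b = (rank x).+1 -> a <> b ->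
  retr_le a y -> retr_le b y ->
  (zero_fiber a <> zero_fiber x /\ zero_fiber b <> zero_fiber x) \/
    zero_fiber y = zero_fiber x ->
  exists c, [/\ retraction c, retr_le a c, retr_le b c, retr_le c y
              & rank c = (rank x).+2].
Proof.
move=> rx ry ra rb xa xb ea eb nab ay byy [[za zb]|zy].
  have [s [p [fs ap e]]] := cover_grow rx ra xa ea za.
  have [s' [p' [fs' ap' e']]] := cover_grow rx rb xb eb zb.
  by rewrite e e' in nab ay byy *; apply: grow_exchange.
have za := zero_fiber_mono ra ry xa ay zy.
have zb := zero_fiber_mono rb ry xb byy zy.
have [s [t [fs ft n1 n2 e]]] := cover_merge rx ra xa ea za.
have [s' [t' [fs' ft' n1' n2' e']]] := cover_merge rx rb xb eb zb.
by rewrite e e' in nab ay byy *; apply: merge_exchange.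
Qed.

End Retractions.

(** * Pointed partitions as retractions *)

Section Representation.
Local Notation opp := Defs.opp.
Context {n : nat}.
Implicit Types (p q : pointed_partitionB n) (i j k : signed n).
Implicit Types (h : {ffun signed n -> signed n}).

Lemma oppK : involutive (@opp n).
Proof. by case=> i b; rewrite /opp /= negbK. Qed.

Lemma opp_neq j : opp j != j.
Proof. by case: j => i b; apply/eqP => -[]; case: b. Qed.

Lemma mem_opps j (S : {set signed n}) : (j \in opps S) = (opp j \in S).
Proof. by rewrite -{1}[j]oppK mem_imset //; apply: can_inj oppK. Qed.

Lemma mem_own_pblock p j : j \in pblock (blocks p) j.
Proof. by rewrite mem_pblock (cover_partition (partition_blocks p)) inE. Qed.

Lemma pblock_blocks p j : pblock (blocks p) j \in blocks p.
Proof. by rewrite pblock_mem // (cover_partition (partition_blocks p)) inE. Qed.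

Lemma blocks_pblock p S j : S \in blocks p -> j \in S -> pblock (blocks p) j = S.
Proof. by have /and3P[_ tp _] := partition_blocks p; apply: def_pblock. Qed.

Lemma block_pblock p S : S \in blocks p -> exists2 j, j \in S & S = pblock (blocks p) j.
Proof.
move=> pS; have /and3P[_ _ p0] := partition_blocks p.
have /set0Pn[j Sj] : S != set0 by apply: contraNneq p0 => <-.
by exists j; rewrite // (blocks_pblock pS).
Qed.

Lemma same_pblock_mem p j k :
  k \in pblock (blocks p) j -> pblock (blocks p) k = pblock (blocks p) j.
Proof. by apply: blocks_pblock; apply: pblock_blocks. Qed.

Lemma opps_block p S : S \in blocks p -> opps S \in blocks p.
Proof.
move=> pS; have /andP[/and4P[_ _ /forall_inP z /forall_inP nz] _] := valP p.
have [Sz|Sz] := boolP (is_zero_block S).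
  by have := z S pS; rewrite Sz => /eqP->.
by have := nz S pS; rewrite Sz.
Qed.

Lemma opps_zero_block p S : S \in blocks p -> is_zero_block S -> opps S = S.
Proof.
move=> pS Sz; have /andP[/and4P[_ _ /forall_inP z _] _] := valP p.
by have := z S pS; rewrite Sz => /eqP.
Qed.

Lemma pblock_opp p j : pblock (blocks p) (opp j) = opps (pblock (blocks p) j).
Proof.
by apply: blocks_pblock; rewrite ?opps_block ?pblock_blocks // mem_opps oppK mem_own_pblock.
Qed.

(** This translates zero blocks into equations between values of [repr]. *)
Lemma zero_block_opp p j : is_zero_block (pblock (blocks p) j) =
  (pblock (blocks p) (opp j) == pblock (blocks p) j).
Proof.
apply/idP/eqP => [jz|e].
  by rewrite pblock_opp (opps_zero_block (pblock_blocks p j)).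
by apply/exists_inP; exists j; rewrite ?mem_own_pblock // -e mem_own_pblock.
Qed.

Definition repr p : {ffun signed n -> signed n} :=
  [ffun j => odflt j [pick k in pblock (blocks p) j :&: points p]].

Lemma pblock_points p j : pblock (blocks p) j :&: points p = [set repr p j].
Proof.
have /andP[_ /forall_inP/(_ _ (pblock_blocks p j))/andP[/cards1P[k e] _]] := valP p.
rewrite -/(blocks p) -/(points p) in e *; rewrite e ffunE; case: pickP => [k'|/(_ k)].
  by rewrite e inE => /eqP->.
by rewrite e inE eqxx.
Qed.

Lemma repr_pblock p j : repr p j \in pblock (blocks p) j.
Proof. by have := set11 (repr p j); rewrite -pblock_points inE => /andP[]. Qed.

Lemma repr_points p j : repr p j \in points p.
Proof. by have := set11 (repr p j); rewrite -pblock_points inE => /andP[]. Qed.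

Lemma repr_uniq p j k :
  k \in pblock (blocks p) j -> k \in points p -> repr p j = k.
Proof.
move=> kj kp; have : k \in [set repr p j] by rewrite -pblock_points inE kj.
by rewrite inE => /eqP.
Qed.

Lemma pblock_repr p j : pblock (blocks p) (repr p j) = pblock (blocks p) j.
Proof. exact: same_pblock_mem (repr_pblock p j). Qed.

Lemma eq_repr p i j :
  (repr p i == repr p j) = (pblock (blocks p) i == pblock (blocks p) j).
Proof.
apply/eqP/eqP => e; first by rewrite -pblock_repr e pblock_repr.
by apply: repr_uniq; rewrite ?repr_points // e repr_pblock.
Qed.

Lemma points_repr p j : (j \in points p) = (repr p j == j).
Proof.
apply/idP/eqP => [jp|<-]; last exact: repr_points.
by apply: repr_uniq; rewrite ?mem_own_pblock.
Qed.

Lemma repr_retraction p : retraction (@opp n) (repr p).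
Proof.
have /andP[/and4P[_ /forall_inP uz _ _] /forall_inP pt] := valP p.
split=> [j|j|j|i j].
- by apply/eqP; rewrite -points_repr repr_points.
- by apply/eqP; rewrite eq_repr !pblock_opp pblock_repr.
- have [jz|jnz] := boolP (is_zero_block (pblock (blocks p) j)).
    by right; apply/eqP; rewrite eq_repr -zero_block_opp.
  left; have /andP[_] := pt _ (pblock_blocks p j); rewrite jnz /= => /eqP e.
  apply: repr_uniq; first by rewrite pblock_opp mem_opps oppK repr_pblock.
  have : opp (repr p j) \in opps (pblock (blocks p) j :&: points p).
    by rewrite mem_opps oppK inE repr_pblock repr_points.
  by rewrite -e inE => /andP[].
move=> /eqP; rewrite eq_repr -zero_block_opp => iz.
move=> /eqP; rewrite eq_repr -zero_block_opp => jz.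
have /forall_inP/(_ _ (pblock_blocks p j)) := uz _ (pblock_blocks p i).
by rewrite iz jz /= -eq_repr => /eqP.
Qed.

Lemma le_repr p q : (p <= q) <-> retr_le (repr p) (repr q).
Proof.
split=> [/andP[/forall_inP pq /subsetP qp] j|pq].
  split; last by apply/eqP; rewrite -points_repr qp ?repr_points.
  have /exists_inP[S qS /subsetP sS] := pq _ (pblock_blocks p j).
  apply/eqP; rewrite eq_repr (blocks_pblock qS (sS _ (repr_pblock p j))).
  by rewrite (blocks_pblock qS (sS _ (mem_own_pblock p j))).
apply/andP; split; last first.
  apply/subsetP => j; rewrite !points_repr => /eqP e.
  by rewrite -{1}e (proj2 (pq j)) e.
apply/forall_inP => S /block_pblock[j _ ->]; apply/exists_inP.
exists (pblock (blocks q) j); first exact: pblock_blocks.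
apply/subsetP => k /same_pblock_mem/eqP; rewrite -eq_repr => /eqP e.
suff /eqP <- : pblock (blocks q) k == pblock (blocks q) j by apply: mem_own_pblock.
by rewrite -eq_repr -(proj1 (pq k)) e (proj1 (pq j)).
Qed.

Lemma repr_inj : injective repr.
Proof.
move=> p q e; apply/le_anti/andP; split; apply/le_repr; rewrite e.
  exact: retr_le_refl (repr_retraction q).
exact: retr_le_refl (repr_retraction q).
Qed.

Lemma lt_repr p q : (p < q) <-> retr_le (repr p) (repr q) /\ repr p <> repr q.
Proof.
rewrite lt_neqAle; split=> [/andP[/eqP npq /le_repr le]|[le npq]].
  by split=> // /repr_inj.
by apply/andP; split; [apply/eqP => e; apply: npq; rewrite e|apply/le_repr].
Qed.

Section Realize.
Variable h : {ffun signed n -> signed n}.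
Hypothesis rh : retraction (@opp n) h.

Let B := preim_partition h [set: signed n].
Let E := [set j | h j == j].
Let fiber j := [set k | h k == h j].

Lemma fiber_partition : partition B [set: signed n].
Proof. exact: preim_partitionP. Qed.

Lemma pblock_fiber j : pblock B j = fiber j.
Proof.
apply/setP => k; rewrite inE pblock_equivalence_partition ?inE 1?eq_sym //.
by move=> a b c _ _ _; split=> // /eqP->.
Qed.

Lemma block_fiber S : S \in B -> exists2 j, j \in S & S = fiber j.
Proof.
have /and3P[_ tB B0] := fiber_partition => BS.
have /set0Pn[j Sj] : S != set0 by apply: contraNneq B0 => <-.
by exists j; rewrite // -pblock_fiber (def_pblock tB BS Sj).
Qed.

Lemma fiber_block j : fiber j \in B.
Proof. by rewrite -pblock_fiber pblock_mem // (cover_partition fiber_partition) inE. Qed.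

Lemma opps_fiber j : opps (fiber j) = fiber (opp j).
Proof.
apply/setP => k; rewrite mem_opps !inE; apply/eqP/eqP => e.
  by rewrite -(retr_neg rh j) -e (retr_neg rh) oppK.
by rewrite -(retr_neg rh k) e (retr_neg rh) oppK.
Qed.

Lemma zero_fiber_block j : is_zero_block (fiber j) -> h (opp j) = h j.
Proof.
case/exists_inP => k; rewrite !inE => /eqP e1 /eqP e2.
by rewrite -(retr_neg rh) -e1 (retr_neg rh) e2.
Qed.

Lemma fiber_points j : fiber j :&: E = [set h j].
Proof.
apply/setP => k; rewrite !inE; apply/andP/eqP => [[/eqP<- /eqP->]//|->].
by rewrite (retr_idem rh) eqxx.
Qed.

Lemma fiber_is_pointed : is_partitionB B && is_pointing B E.
Proof.
apply/andP; split.
  apply/and4P; split; first exact: fiber_partition.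
  - apply/forall_inP => S /block_fiber[i _ ->]; apply/forall_inP => S'.
    case/block_fiber=> j _ ->; apply/implyP => /zero_fiber_block iz.
    apply/implyP => /zero_fiber_block jz; apply/eqP/setP => k.
    by rewrite !inE (retr_zero rh iz jz).
  - apply/forall_inP => S /block_fiber[j _ ->]; apply/implyP.
    by move/zero_fiber_block => jz; rewrite opps_fiber; apply/eqP/setP => k; rewrite !inE jz.
  - apply/forall_inP => S /block_fiber[j _ ->]; apply/implyP => _.
    by rewrite opps_fiber fiber_block.
apply/forall_inP => S /block_fiber[j _ ->]; rewrite opps_fiber !fiber_points cards1 eqxx /=.
apply/implyP => nz; rewrite opps1; apply/eqP; congr [set _].
case: (retr_pm rh j) => // e; case/negP: nz.
by apply/exists_inP; exists j; rewrite inE ?e.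
Qed.

(** The blocks are the fibers and the points are the fixed points. *)
Lemma realize : exists p, repr p = h.
Proof.
exists (@PointedPartitionB n (B, E) fiber_is_pointed); apply/ffunP => j.
apply: repr_uniq; first by rewrite [blocks _]/= pblock_fiber inE (retr_idem rh).
by rewrite [points _]/= inE (retr_idem rh).
Qed.

End Realize.

Definition ppB_rank p := rank (@opp n) (repr p).

Definition ppB_zero p := zero_fiber (@opp n) (repr p).

Lemma ppB_growth : growth ppB_rank ppB_zero.
Proof.
have rr := repr_retraction.
have lt_rank x q : retr_le (repr x) (repr q) -> ppB_rank q = (ppB_rank x).+1 -> x < q.
  move=> le e; apply/lt_repr; split=> // e'; move: e; rewrite /ppB_rank e'.
  exact: n_Sn.
split.
- move=> x y /lt_repr[le nxy]; exact: rank_lt oppK opp_neq _ _ (rr x) (rr y) le nxy.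
- move=> x y /lt_repr[le nxy].
  have [k [rk xk ky ek]] := retr_step oppK opp_neq (rr x) (rr y) le nxy.
  have [q eq] := realize rk; rewrite -eq in xk ky ek.
  by exists q; split=> //; [apply: lt_rank|apply/le_repr].
- move=> x y b /le_repr xy /le_repr yb.
  exact: zero_fiber_mono (rr y) (rr b) xy yb.
- move=> x y /le_repr xy nz.
  have [k [rk xk ky ek zk]] := grow_step oppK opp_neq (rr x) (rr y) xy nz.
  have [q eq] := realize rk; rewrite -eq in xk ky ek zk.
  by exists q; split; [exact: lt_rank|exact/le_repr|exact: ek|exact: zk].
- move=> x a b c /lt_repr[xa _] /lt_repr[xb _] ea eb za zb nab /le_repr ac /le_repr bc.
  have nab' : repr a <> repr b by move/repr_inj.
  exact: grow_indep oppK opp_neq _ _ _ _ (rr x) (rr a) (rr b) (rr c)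
    xa xb ea eb za zb nab' ac bc.
move=> x a b y /lt_repr[xa _] /lt_repr[xb _] ea eb nab /le_repr ay /le_repr byy z.
have nab' : repr a <> repr b by move/repr_inj.
have [c [rc ac bc cy ec]] :=
  retr_exchange oppK opp_neq (rr x) (rr y) (rr a) (rr b) xa xb ea eb nab' ay byy z.
have [q eq] := realize rc; rewrite -eq in ac bc cy ec.
by exists q; split=> //; apply/le_repr.
Qed.

End Representation.

(** All the elements provided by the axioms lie between two given ones, so they stay
    in the interval. *)
Lemma growth_interval d (P : finPOrderType d) (T : eqType) (rho : P -> nat)
    (Z : P -> T) (x0 y0 : P) (le0 : x0 <= y0) : growth rho Z ->
  growth (fun x : closed_interval le0 => rho (val x)) (fun x => Z (val x)).
Proof.
move=> gP; pose V (x : closed_interval le0) : P := val x.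
have leV (x y : closed_interval le0) : (x <= y) = (V x <= V y) by rewrite -Order.le_val.
have ltV (x y : closed_interval le0) : (x < y) = (V x < V y) by rewrite !lt_neqAle leV (inj_eq val_inj).
have lift (x y : closed_interval le0) k : V x <= k -> k <= V y -> exists z, V z = k.
  move=> xk ky; have k_in : x0 <= k <= y0.
    have /andP[x0x _] := valP x; have /andP[_ yy0] := valP y.
    by rewrite (le_trans x0x xk) (le_trans ky yy0).
  by exists (ClosedInterval le0 k_in).
split.
- by move=> x y; rewrite ltV; apply: (growth_lt gP).
- move=> x y; rewrite ltV => /(growth_step gP)[k [xk ky ek]].
  have [z ez] := lift x y k (ltW xk) ky; exists z.
  by rewrite ltV leV -/(V z) ez.
- by move=> x y b; rewrite !leV; apply: (growth_mono gP).
- move=> x y; rewrite leV => xy /(growth_grow gP xy)[k [xk ky ek zk]].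
  have [z ez] := lift x y k (ltW xk) ky; exists z.
  by rewrite ltV leV -/(V z) ez.
- move=> x a b c; rewrite !ltV !leV => xa xb ea eb za zb nab.
  by apply: (growth_indep gP xa xb ea eb za zb) => /val_inj.
move=> x a b y; rewrite !ltV !leV => xa xb ea eb nab ay byy z.
have nab' : V a <> V b by move/val_inj.
have [c [ac bc cy ec]] := growth_exchange gP xa xb ea eb nab' ay byy z.
have [w ew] := lift a y c ac cy; exists w.
by rewrite !leV -/(V w) ew.
Qed.

Theorem theorem1p16 (n : nat) (hn : (1 <= n)%N)
    (a : pointed_partitionB n) (ha : maximal a) :
  CL_shellable (PiB' a) /\ cohen_macaulay (PiB' a).
Proof.
have gP := growth_interval (le0x a) (@ppB_growth n).
split; first exact: growth_CL_shellable gP.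
by split=> [|K]; apply: growth_cohen_macaulay_over gP.
Qed.
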